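(* Let $L>0$ and let $\mathscr A$ be the total arclength functional on $\mathcal Q_L$, defined by $$\mathscr A([\gamma])=\int_0^L\langle\gamma_x,\gamma_x\rangle^{1/2}\,dx .$$ Then the Hamiltonian vector field (with respect to $\Omega$) of the functional $4\mathscr A$ is equivalent to (i.e. is represented at $[\gamma]$ by) the vector field along $\gamma$ $$\frac{k_x}{\langle\gamma_x,\gamma_x\rangle}(\mathrm i\gamma_x)+2k(\mathrm i\gamma),$$ where $k$ is the curvature of $\gamma$.
   Context: $S^3\subset\mathbb C^2$ is the set of unit vectors for the standard Hermitian inner product $\langle\cdot,\cdot\rangle$ (linear in the first slot). A regular smooth curve $\gamma:\mathbb R\to S^3$ with parameter $x$ is Legendrian if $\langle\gamma_x,\gamma\rangle=0$. Its curvature is $k=\mathrm{Im}\langle\gamma_{xx},\gamma_x\rangle/\langle\gamma_x,\gamma_x\rangle^{3/2}$. $\mathcal P_L$ is the (infinite-dimensional) manifold of regular Legendrian curves that are $L$-periodic in $x$. Its tangent vectors at $\gamma$ are the vector fields along $\gamma$ of the form $\mathbf V=p\gamma_x+q(\mathrm i\gamma_x)+r(\mathrm i\gamma)$ with $p,q,r$ real-valued smooth $L$-periodic functions and $r_x=2q\langle\gamma_x,\gamma_x\rangle$. $\mathcal Q_L$ is the quotient of $\mathcal P_L$ by the group generated by the flows of $\mathrm i\gamma$ (constant rotations $\gamma\mapsto e^{\mathrm i\theta}\gamma$) and of $f(x)\gamma_x$ with $f$ $L$-periodic (period-preserving reparametrizations). Tangent vectors of $\mathcal Q_L$ at $[\gamma]$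 are equivalence classes of elements of $T_\gamma\mathcal P_L$, two being equivalent if they differ by a constant real multiple of $\mathrm i\gamma$ plus some $f(x)\gamma_x$ with $f$ $L$-periodic. The symplectic form on $\mathcal Q_L$ is $\Omega_{[\gamma]}(\mathcal V,\mathcal W)=-\int_0^L\det_{\mathbb R}(\gamma,\gamma_x,\mathbf V,\mathbf W)\,dx$ for any representatives $\mathbf V,\mathbf W$, where $\det_{\mathbb R}$ is the determinant of the $4\times4$ real matrix obtained by identifying each $(z_1,z_2)^T\in\mathbb C^2$ with $(\mathrm{Re}\,z_1,\mathrm{Im}\,z_1,\mathrm{Re}\,z_2,\mathrm{Im}\,z_2)^T$. The Hamiltonian vector field $\mathcal W_{\mathscr H}$ of a smooth functional $\mathscr H:\mathcal Q_L\to\mathbb R$ is defined by $d\mathscr H_{[\gamma]}(\mathcal V)=\Omega_{[\gamma]}(\mathcal V,\mathcal W_{\mathscr H})$ for all $\mathcal V\in T_{[\gamma]}\mathcal Q_L$. *)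

(* Defs.v *)
From Stdlib Require Import Reals List.
From mathcomp Require Import ssreflect ssrfun ssrbool fintype ssralg matrix.
From mathcomp Require Import Rstruct.
From Coquelicot Require Import Coquelicot.

Local Open Scope R_scope.

(** * Linear algebra in C^2 *)

Definition C2 : Type := (C * C)%type.

Definition addC2 (z w : C2) : C2 := (Cplus (fst z) (fst w), Cplus (snd z) (snd w)).
Definition subC2 (z w : C2) : C2 := (Cminus (fst z) (fst w), Cminus (snd z) (snd w)).
Definition scaleC2 (a : C) (z : C2) : C2 := (Cmult a (fst z), Cmult a (snd z)).
Definition iC2 (z : C2) : C2 := scaleC2 Ci z.

Definition hdot (z w : C2) : C :=
  Cplus (Cmult (fst z) (Cconj (fst w))) (Cmult (snd z) (Cconj (snd w))).

(* <z,z> as a real number; its imaginary part vanishes. *)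
Definition hnorm2 (z : C2) : R := Re (hdot z z).

Definition coord (z : C2) (j : nat) : R :=
  List.nth j (Re (fst z) :: Im (fst z) :: Re (snd z) :: Im (snd z) :: nil) 0.

(* Determinant of the real 4x4 matrix with columns a, b, c, d. *)
Definition detR (a b c d : C2) : R :=
  determinant (\matrix_(i < 4, j < 4)
    coord (List.nth (nat_of_ord j) (a :: b :: c :: d :: nil) a) (nat_of_ord i)).

(** * Smooth curves and vector fields along them *)

Definition DerC (f : R -> C) (x : R) : C :=
  (Derive (fun t => Re (f t)) x, Derive (fun t => Im (f t)) x).
Definition DerC2 (g : R -> C2) (x : R) : C2 :=
  (DerC (fun t => fst (g t)) x, DerC (fun t => snd (g t)) x).

Definition smooth (f : R -> R) : Prop := forall n x, ex_derive_n f n x.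
Definition smoothC2 (g : R -> C2) : Prop := forall j, smooth (fun x => coord (g x) j).
Definition periodic {T : Type} (L : R) (f : R -> T) : Prop := forall x, f (x + L) = f x.

Definition speed2 (g : R -> C2) (x : R) : R := hnorm2 (DerC2 g x).

Definition curvature (g : R -> C2) (x : R) : R :=
  Im (hdot (DerC2 (DerC2 g) x) (DerC2 g x)) / Rpower (speed2 g x) (3 / 2).

Record regular_legendrian (g : R -> C2) : Prop := {
  rl_smooth : smoothC2 g;
  rl_sphere : forall x, hdot (g x) (g x) = RtoC 1;
  rl_regular : forall x, DerC2 g x <> (RtoC 0, RtoC 0);
  rl_legendrian : forall x, hdot (DerC2 g x) (g x) = RtoC 0
}.

Definition P_space (L : R) (g : R -> C2) : Prop :=
  regular_legendrian g /\ periodic L g.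

(* p gamma_x + q (i gamma_x) + r (i gamma) *)
Definition frame_field (g : R -> C2) (p q r : R -> R) (x : R) : C2 :=
  addC2 (scaleC2 (RtoC (p x)) (DerC2 g x))
    (addC2 (scaleC2 (RtoC (q x)) (iC2 (DerC2 g x)))
           (scaleC2 (RtoC (r x)) (iC2 (g x)))).

Definition tangent_P (L : R) (g V : R -> C2) : Prop :=
  exists p q r : R -> R,
    (smooth p /\ smooth q /\ smooth r) /\
    (periodic L p /\ periodic L q /\ periodic L r) /\
    (forall x, Derive r x = 2 * q x * speed2 g x) /\
    (forall x, V x = frame_field g p q r x).

(** * The quotient Q_L *)

(* gamma and eta lie in the same orbit: eta is obtained from gamma by a constant
   rotation and an orientation-preserving, period-preserving reparametrization. *)
Definition Q_equiv (L : R) (g h : R -> C2) : Prop :=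
  exists (theta : R) (phi : R -> R),
    smooth phi /\ (forall x, 0 < Derive phi x) /\
    (forall x, phi (x + L) = phi x + L) /\
    (forall x, h x = scaleC2 (cos theta, sin theta) (g (phi x))).

Definition functional_on_Q (L : R) (H : (R -> C2) -> R) : Prop :=
  forall g h, P_space L g -> P_space L h -> Q_equiv L g h -> H g = H h.

(* V and W represent the same tangent vector of Q_L at the class of gamma. *)
Definition tangent_equiv (L : R) (g V W : R -> C2) : Prop :=
  tangent_P L g V /\ tangent_P L g W /\
  exists (c : R) (f : R -> R), smooth f /\ periodic L f /\
    forall x, subC2 (V x) (W x) =
      addC2 (scaleC2 (RtoC c) (iC2 (g x))) (scaleC2 (RtoC (f x)) (DerC2 g x)).

(** * Differentials, symplectic form, Hamiltonian vector fields *)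

(* G is a smooth family e |-> G e of points of P_L, defined for |e| < delta,
   with G 0 = gamma and initial velocity V.  Smoothness is joint in (e, x). *)
Definition variation (L : R) (g V : R -> C2) (G : R -> R -> C2) : Prop :=
  (forall x, G 0 x = g x) /\
  (forall x, DerC2 (fun e => G e x) 0 = V x) /\
  exists delta : R, 0 < delta /\ forall e, Rabs e < delta ->
    P_space L (G e) /\
    forall j n x, ex_diff_n (fun s y => coord (G s y) j) n e x.

(* dH at gamma in direction V equals c.  The existence clause makes the value c
   unique instead of leaving it arbitrary when V is not a velocity. *)
Definition is_differential (L : R) (H : (R -> C2) -> R) (g V : R -> C2) (c : R) : Prop :=
  (exists G, variation L g V G) /\
  (forall G, variation L g V G -> is_derive (fun e => H (G e)) 0 c).

Definition Omega (L : R) (g V W : R -> C2) : R :=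
  - RInt (fun x => detR (g x) (DerC2 g x) (V x) (W x)) 0 L.

(* W represents, at the class of gamma, the Hamiltonian vector field of H. *)
Definition hamiltonian_rep (L : R) (H : (R -> C2) -> R) (g W : R -> C2) : Prop :=
  tangent_P L g W /\
  forall V, tangent_P L g V -> is_differential L H g V (Omega L g V W).

Definition arclength (L : R) (g : R -> C2) : R :=
  RInt (fun x => sqrt (speed2 g x)) 0 L.

(* Main.v *)
Require Import Defs.
From Stdlib Require Import Reals Lra ZArith.
From mathcomp Require ssreflect ssrfun ssrbool fintype ssralg bigop matrix.
From mathcomp Require Rstruct.
From Coquelicot Require Import Coquelicot.

Local Open Scope R_scope.

(** Write s = <g_x,g_x>, v = sqrt s and m = Im <g_xx,g_x>, so that k = m / v^3, and
    describe a tangent vector p g_x + q (i g_x) + r (i g) by its coefficients;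
    the tangency condition is r_x = 2 q s.

    The form.  Since g, g_x, i g_x, i g is an orthogonal real frame, the
    determinant of g, g_x, V, W is (q1 r2 - r1 q2) s = (r1' r2 - r1 r2') / 2, and
    integration by parts over a period leaves Omega(V, W) = - int r1' r2
    ([Omega_frame]): the form sees only the coefficients r.

    The differential.  Along a variation with velocity V the derivative of the
    arclength is int Re <V_x,g_x> / v = int ((p v)' - q m / v).  The first term
    integrates to 0, and q m / v = q s k = r' k / 2, so d(4A)(V) = - int r' (2k)
    ([first_variation]).  This equals Omega(V, W) as soon as the coefficient r of W
    is 2k, and tangency then forces its coefficient q to be k_x / s.

    Uniqueness.  If W has coefficient r and also represents the Hamiltonian field,
    then rho = r - 2k satisfies int u' rho = 0 for every periodic u, because every
    such u is the coefficient r of a tangent vector.  Taking u = rho' gives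
    int (rho')^2 = 0, so rho is a constant ([constant_of_orthogonal]), and W differs
    from the field of the theorem by a constant multiple of i g plus a multiple
    of g_x.

    Velocities.  The differential is tested along actual families of closed
    Legendrian curves, so every tangent vector has to be integrated to one
    ([variation_exists]).  The family is explicit: with a real function y put

        e^(i e r) (g + y i g_x) / sqrt (1 + y^2 s).

    This curve lies in the sphere, and it is Legendrian exactly when
    e r_x (1 + y^2 s) = 2 y s - y^2 m ([unit_push_legendrian]).  Because r_x = 2 q s,
    this is a quadratic equation for y at each point, with periodic coefficients;
    its small root [contact_root] is therefore periodic, so the curve closes up
    without solving any differential equation.  The root starts as y = e q + O(e^2),
    which gives the velocity q (i g_x) + r (i g); the tangential part p g_x comes
    from substituting x + e p(x) for x.  Joint smoothness in (e, x) follows from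
    closure properties of the functions smooth on a strip |e| < d. *)

(** * Functions of one variable *)

Lemma smooth_ex_derive f x : smooth f -> ex_derive f x.
Proof. intros H; exact (H 1%nat x). Qed.

Lemma smooth_is_derive f x : smooth f -> is_derive f x (Derive f x).
Proof. intros H; apply Derive_correct, smooth_ex_derive, H. Qed.

Lemma smooth_continuity f x : smooth f -> continuity_pt f x.
Proof.
intros H; apply continuity_pt_filterlim, (ex_derive_continuous f), smooth_ex_derive, H.
Qed.

Lemma smooth_continuous f x : smooth f -> continuous f x.
Proof. intros H; apply (ex_derive_continuous f), smooth_ex_derive, H. Qed.

Lemma smooth_Derive f : smooth f -> smooth (Derive f).
Proof.
intros H [|n] x; [exact I|].
apply (ex_derive_ext (Derive_n f (S n))); [|exact (H (S (S n)) x)].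
intros t; symmetry; rewrite <- (Nat.add_1_r n); exact (Derive_n_comp f n 1 t).
Qed.

Lemma smooth_of_Derive f : (forall x, ex_derive f x) -> smooth (Derive f) -> smooth f.
Proof.
intros H1 H2 [|[|n]] x; [exact I|apply H1|].
apply (ex_derive_ext (Derive_n (Derive f) n)); [|exact (H2 (S n) x)].
intros t; rewrite <- (Nat.add_1_r n); exact (Derive_n_comp f n 1 t).
Qed.

Lemma smooth_ext f g : (forall x, f x = g x) -> smooth f -> smooth g.
Proof. intros E H n x; apply (ex_derive_n_ext f); auto. Qed.

Lemma smooth_const c : smooth (fun _ => c).
Proof. intros [|n] x; [exact I|]; apply ex_derive_n_const. Qed.

Lemma smooth_id : smooth (fun x => x).
Proof.
apply smooth_of_Derive; [intros x; auto_derive; auto|].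
apply (smooth_ext (fun _ => 1)); [intros x; symmetry; apply Derive_id|apply smooth_const].
Qed.

(** * Smooth functions on a strip *)

(** The parameter e is confined to |e| < d while x is free: the domain on which
    families of curves are given.  Working at a fixed order n lets the closure
    properties be proved by induction on n, since the partial derivatives of a
    product, inverse or composite are built from functions of one order less. *)
Definition diff_strip (d : R) (n : nat) (f : R -> R -> R) : Prop :=
  forall e x, Rabs e < d -> ex_diff_n f n e x.
Definition smooth_strip (d : R) (f : R -> R -> R) : Prop :=
  forall n, diff_strip d n f.

Lemma strip_open d e : Rabs e < d -> locally e (fun u => Rabs u < d).
Proof.
intros He.
assert (Hp : 0 < d - Rabs e) by lra.
exists (mkposreal _ Hp); intros u Hu.
change (Rabs (u - e) < d - Rabs e) in Hu.
replace u with ((u - e) + e) by ring.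
generalize (Rabs_triang (u - e) e); lra.
Qed.

Lemma strip_open_2d d e x : Rabs e < d -> locally_2d (fun u _ => Rabs u < d) e x.
Proof.
intros He; destruct (strip_open d e He) as [r Hr].
exists r; intros u v Hu _; exact (Hr u Hu).
Qed.

(** The strip is open, so agreement there suffices for all partial derivatives;
    inverses and square roots behave well on the strip only. *)
Lemma diff_strip_ext d n f g :
  (forall e x, Rabs e < d -> f e x = g e x) -> diff_strip d n f -> diff_strip d n g.
Proof.
revert f g; induction n as [|n IH]; intros f g E Hf e x He;
  generalize (Hf e x He); simpl; intros [Hc H].
- split; auto.
  apply (continuity_2d_pt_ext_loc f); auto.
  eapply locally_2d_impl; [|apply (strip_open_2d d e x He)].
  apply locally_2d_forall; auto.
- destruct H as (D1 & D2 & _).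
  assert (E1 : forall y, locally e (fun u => f u y = g u y)).
  { intros y; eapply filter_imp; [|apply (strip_open d e He)]; simpl; auto. }
  repeat split.
  + apply (continuity_2d_pt_ext_loc f); auto.
    eapply locally_2d_impl; [|apply (strip_open_2d d e x He)].
    apply locally_2d_forall; auto.
  + exact (ex_derive_ext_loc _ _ e (E1 x) D1).
  + apply (ex_derive_ext (f e)); auto.
  + apply (IH (fun u v => Derive (fun z => f z v) u)); auto.
    * intros e' x' He'; apply Derive_ext_loc.
      eapply filter_imp; [|apply (strip_open d e' He')]; simpl; auto.
    * intros e' x' He'; apply (Hf e' x' He').
  + apply (IH (fun u v => Derive (fun z => f u z) v)); auto.
    * intros e' x' He'; apply Derive_ext; auto.
    * intros e' x' He'; apply (Hf e' x' He').
Qed.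

(** Any expressions for the two partial derivatives will do, which turns each
    closure property below into a computation of derivatives. *)
Lemma diff_strip_intro d n f fe fx :
  (forall e x, Rabs e < d -> continuity_2d_pt f e x) ->
  (forall e x, Rabs e < d -> is_derive (fun u => f u x) e (fe e x)) ->
  (forall e x, Rabs e < d -> is_derive (f e) x (fx e x)) ->
  diff_strip d n fe -> diff_strip d n fx -> diff_strip d (S n) f.
Proof.
intros Hc He Hx Se Sx e x Hd; simpl; repeat split; auto.
- eexists; exact (He e x Hd).
- eexists; exact (Hx e x Hd).
- apply (diff_strip_ext d n fe); auto.
  intros e' x' H'; symmetry; apply is_derive_unique; auto.
- apply (diff_strip_ext d n fx); auto.
  intros e' x' H'; symmetry; apply is_derive_unique; exact (Hx _ _ H').
Qed.

Definition partial_e (f : R -> R -> R) (e x : R) : R := Derive (fun u => f u x) e.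
Definition partial_x (f : R -> R -> R) (e x : R) : R := Derive (fun y => f e y) x.

Lemma diff_strip_elim d n f : diff_strip d (S n) f ->
  (forall e x, Rabs e < d -> continuity_2d_pt f e x) /\
  (forall e x, Rabs e < d -> is_derive (fun u => f u x) e (partial_e f e x)) /\
  (forall e x, Rabs e < d -> is_derive (f e) x (partial_x f e x)) /\
  diff_strip d n (partial_e f) /\ diff_strip d n (partial_x f).
Proof.
intros H; split; [|split; [|split; [|split]]]; intros e x He;
  destruct (H e x He) as (Hc & D1 & D2 & H1 & H2); auto.
- exact (Derive_correct _ _ D1).
- exact (Derive_correct _ _ D2).
Qed.

Lemma diff_strip_pred d n f : diff_strip d (S n) f -> diff_strip d n f.
Proof.
revert f; induction n as [|n IH]; intros f H.
- intros e x He; split; [apply (H e x He)|exact I].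
- destruct (diff_strip_elim d (S n) f H) as (Hc & D1 & D2 & H1 & H2).
  apply (diff_strip_intro d n f (partial_e f) (partial_x f)); auto.
Qed.

Lemma diff_strip_cont d n f e x : diff_strip d n f -> Rabs e < d -> continuity_2d_pt f e x.
Proof. intros H He; destruct n; apply (H e x He). Qed.

Lemma diff_strip_const d n c : diff_strip d n (fun _ _ => c).
Proof.
revert c; induction n as [|n IH]; intros c.
- intros e x _; split; auto; apply continuity_2d_pt_const.
- apply (diff_strip_intro d n _ (fun _ _ => 0) (fun _ _ => 0)); auto; intros.
  + apply continuity_2d_pt_const.
  + auto_derive; auto.
  + auto_derive; auto.
Qed.

Lemma diff_strip_param d n : diff_strip d n (fun e _ => e).
Proof.
destruct n as [|n].
- intros e x _; split; auto; apply continuity_2d_pt_id1.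
- apply (diff_strip_intro d n _ (fun _ _ => 1) (fun _ _ => 0)); auto using diff_strip_const; intros.
  + apply continuity_2d_pt_id1.
  + auto_derive; auto.
  + auto_derive; auto.
Qed.

Lemma diff_strip_plus d n f g : diff_strip d n f -> diff_strip d n g ->
  diff_strip d n (fun e x => f e x + g e x).
Proof.
revert f g; induction n as [|n IH]; intros f g Hf Hg.
- intros e x He; split; auto.
  apply continuity_2d_pt_plus; [apply (Hf e x He)|apply (Hg e x He)].
- destruct (diff_strip_elim _ _ _ Hf) as (Cf & F1 & F2 & F3 & F4).
  destruct (diff_strip_elim _ _ _ Hg) as (Cg & G1 & G2 & G3 & G4).
  apply (diff_strip_intro d n _ (fun e x => partial_e f e x + partial_e g e x)
     (fun e x => partial_x f e x + partial_x g e x)); auto; intros.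
  + apply continuity_2d_pt_plus; auto.
  + apply (is_derive_plus (V := R_NormedModule)); auto.
  + apply (is_derive_plus (V := R_NormedModule)); auto.
Qed.

Lemma diff_strip_mult d n f g : diff_strip d n f -> diff_strip d n g ->
  diff_strip d n (fun e x => f e x * g e x).
Proof.
revert f g; induction n as [|n IH]; intros f g Hf Hg.
- intros e x He; split; auto.
  apply continuity_2d_pt_mult; [apply (Hf e x He)|apply (Hg e x He)].
- destruct (diff_strip_elim _ _ _ Hf) as (Cf & F1 & F2 & F3 & F4).
  destruct (diff_strip_elim _ _ _ Hg) as (Cg & G1 & G2 & G3 & G4).
  apply diff_strip_pred in Hf; apply diff_strip_pred in Hg.
  apply (diff_strip_intro d n _ (fun e x => partial_e f e x * g e x + f e x * partial_e g e x)
     (fun e x => partial_x f e x * g e x + f e x * partial_x g e x));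
    auto using diff_strip_plus; intros.
  + apply continuity_2d_pt_mult; auto.
  + apply (is_derive_mult (fun u => f u x) (fun u => g u x)); auto; exact Rmult_comm.
  + apply (is_derive_mult (f e) (g e)); auto; exact Rmult_comm.
Qed.

Lemma diff_strip_opp d n f : diff_strip d n f -> diff_strip d n (fun e x => - f e x).
Proof.
intros Hf; apply (diff_strip_ext d n (fun e x => (-1) * f e x)); [intros; ring|].
apply diff_strip_mult; auto using diff_strip_const.
Qed.

Lemma diff_strip_inv d n f : (forall e x, Rabs e < d -> f e x <> 0) ->
  diff_strip d n f -> diff_strip d n (fun e x => / f e x).
Proof.
intros Hn; induction n as [|n IH]; intros Hf.
- intros e x He; split; auto.
  apply continuity_2d_pt_inv; auto; apply (Hf e x He).
- destruct (diff_strip_elim _ _ _ Hf) as (Cf & F1 & F2 & F3 & F4).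
  specialize (IH (diff_strip_pred _ _ _ Hf)).
  apply (diff_strip_intro d n _ (fun e x => - (partial_e f e x * (/ f e x * / f e x)))
     (fun e x => - (partial_x f e x * (/ f e x * / f e x))));
    auto using diff_strip_opp, diff_strip_mult; intros e x He.
  + apply continuity_2d_pt_inv; auto.
  + replace (- _) with (- partial_e f e x / f e x ^ 2) by (field; auto).
    apply (is_derive_inv (fun u => f u x)); auto.
  + replace (- _) with (- partial_x f e x / f e x ^ 2) by (field; auto).
    apply (is_derive_inv (f e)); auto.
Qed.

Lemma diff_strip_sqrt d n f : (forall e x, Rabs e < d -> 0 < f e x) ->
  diff_strip d n f -> diff_strip d n (fun e x => sqrt (f e x)).
Proof.
intros Hp.
assert (Hs : forall e x, Rabs e < d -> sqrt (f e x) <> 0).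
{ intros e x He; apply Rgt_not_eq, sqrt_lt_R0; auto. }
induction n as [|n IH]; intros Hf.
- intros e x He; split; auto.
  apply continuity_1d_2d_pt_comp; [|apply (Hf e x He)].
  apply continuity_pt_sqrt; left; auto.
- destruct (diff_strip_elim _ _ _ Hf) as (Cf & F1 & F2 & F3 & F4).
  specialize (IH (diff_strip_pred _ _ _ Hf)).
  apply (diff_strip_intro d n _ (fun e x => partial_e f e x * (/ 2 * / sqrt (f e x)))
     (fun e x => partial_x f e x * (/ 2 * / sqrt (f e x))));
    auto 6 using diff_strip_mult, diff_strip_const, diff_strip_inv; intros e x He.
  + apply continuity_1d_2d_pt_comp; auto.
    apply continuity_pt_sqrt; left; auto.
  + replace (_ * _) with (partial_e f e x / (2 * sqrt (f e x))) by (field; auto).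
    apply (is_derive_sqrt (fun u => f u x)); auto.
  + replace (_ * _) with (partial_x f e x / (2 * sqrt (f e x))) by (field; auto).
    apply (is_derive_sqrt (f e)); auto.
Qed.

Lemma diff_strip_sin_cos d n f : diff_strip d n f ->
  diff_strip d n (fun e x => sin (f e x)) /\ diff_strip d n (fun e x => cos (f e x)).
Proof.
induction n as [|n IH]; intros Hf.
- split; intros e x He; split; auto;
    (apply continuity_1d_2d_pt_comp; [|apply (Hf e x He)]);
    [apply continuity_sin|apply continuity_cos].
- destruct (diff_strip_elim _ _ _ Hf) as (Cf & F1 & F2 & F3 & F4).
  destruct (IH (diff_strip_pred _ _ _ Hf)) as [Is Ic].
  split.
  + apply (diff_strip_intro d n _ (fun e x => partial_e f e x * cos (f e x))
     (fun e x => partial_x f e x * cos (f e x))); auto using diff_strip_mult; intros e x He.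
    * apply continuity_1d_2d_pt_comp; auto; apply continuity_sin.
    * apply (is_derive_comp sin (fun u => f u x)); auto; apply is_derive_sin.
    * apply (is_derive_comp sin (f e)); auto; apply is_derive_sin.
  + apply (diff_strip_intro d n _ (fun e x => partial_e f e x * - sin (f e x))
     (fun e x => partial_x f e x * - sin (f e x)));
     auto using diff_strip_mult, diff_strip_opp; intros e x He.
    * apply continuity_1d_2d_pt_comp; auto; apply continuity_cos.
    * apply (is_derive_comp cos (fun u => f u x)); auto; apply is_derive_cos.
    * apply (is_derive_comp cos (f e)); auto; apply is_derive_cos.
Qed.

Lemma diff_strip_cont_comp f p e x : smooth f -> smooth p ->
  continuity_2d_pt (fun u y => f (y + u * p y)) e x.
Proof.
intros Hf Hp; apply continuity_1d_2d_pt_comp; [apply smooth_continuity, Hf|].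
apply continuity_2d_pt_plus; [apply continuity_2d_pt_id2|].
apply continuity_2d_pt_mult; [apply continuity_2d_pt_id1|].
apply (continuity_1d_2d_pt_comp p (fun _ y => y));
  [apply smooth_continuity, Hp|apply continuity_2d_pt_id2].
Qed.

(** The reparametrizations y = x + e p(x) are the only substitutions that
    deformations below require. *)
Lemma diff_strip_comp d n f p : smooth f -> smooth p ->
  diff_strip d n (fun e x => f (x + e * p x)).
Proof.
revert f p; induction n as [|n IH]; intros f p Hf Hp.
- intros e x He; split; auto; apply diff_strip_cont_comp; auto.
- assert (H0 : forall f', smooth f' -> diff_strip d n (fun _ x => f' x)).
  { intros f' Hf'; apply (diff_strip_ext d n (fun e x => f' (x + e * 0))).
    - intros; f_equal; ring.
    - apply (IH f' (fun _ => 0) Hf'), smooth_const. }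
  apply (diff_strip_intro d n _ (fun e x => p x * Derive f (x + e * p x))
     (fun e x => (1 + e * Derive p x) * Derive f (x + e * p x))).
  + intros; apply diff_strip_cont_comp; auto.
  + intros e x _.
    apply (is_derive_comp f (fun u => x + u * p x)); [apply smooth_is_derive, Hf|].
    auto_derive; auto; ring.
  + intros e x _.
    apply (is_derive_comp f (fun y => y + e * p y)); [apply smooth_is_derive, Hf|].
    auto_derive; [apply smooth_ex_derive, Hp|].
    change (fun x0 => p x0) with p; ring.
  + apply diff_strip_mult; [exact (H0 p Hp)|apply IH; auto using smooth_Derive].
  + apply diff_strip_mult; [|apply IH; auto using smooth_Derive].
    apply diff_strip_plus; [apply diff_strip_const|].
    apply diff_strip_mult; [apply diff_strip_param|].
    apply H0, smooth_Derive, Hp.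
Qed.

Lemma smooth_slice d f e : smooth_strip d f -> Rabs e < d -> smooth (f e).
Proof.
intros Hf He n; specialize (Hf n); revert f Hf.
induction n as [|n IH]; intros f Hf x; [exact I|].
destruct (diff_strip_elim _ _ _ Hf) as (_ & _ & D & _ & H).
destruct n as [|n].
- eexists; exact (D e x He).
- apply (ex_derive_ext (Derive_n (Derive (f e)) n)).
  + intros t; rewrite <- (Nat.add_1_r n); exact (Derive_n_comp (f e) n 1 t).
  + exact (IH (partial_x f) H x).
Qed.
Lemma mixed_partials d f e x : diff_strip d 2 f -> Rabs e < d ->
  partial_e (partial_x f) e x = partial_x (partial_e f) e x.
Proof.
intros Hf He.
destruct (diff_strip_elim d 1 _ Hf) as (_ & De & Dx & Fe & Fx).
destruct (diff_strip_elim d 0 _ Fe) as (_ & _ & Dex & _ & Cex).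
destruct (diff_strip_elim d 0 _ Fx) as (_ & Dxe & _ & Cxe & _).
apply (Schwarz f e x).
- eapply locally_2d_impl; [|apply (strip_open_2d d e x He)].
  apply locally_2d_forall; intros u v Hu; repeat split.
  + eexists; exact (De u v Hu).
  + eexists; exact (Dx u v Hu).
  + eexists; exact (Dxe u v Hu).
  + eexists; exact (Dex u v Hu).
- exact (diff_strip_cont d 0 _ e x Cxe He).
- exact (diff_strip_cont d 0 _ e x Cex He).
Qed.

Lemma smooth_strip_comp d f p : smooth f -> smooth p ->
  smooth_strip d (fun e x => f (x + e * p x)).
Proof. intros Hf Hp n; apply diff_strip_comp; auto. Qed.

(** A function of x is a family that is constant in e; together with [smooth_slice]
    this transfers the closure properties on strips to one variable. *)
Lemma smooth_strip_lift d f : smooth f -> smooth_strip d (fun _ x => f x).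
Proof.
intros Hf n; apply (diff_strip_ext d n (fun e x => f (x + e * 0))).
- intros; f_equal; ring.
- apply (diff_strip_comp d n f (fun _ => 0)); auto; apply smooth_const.
Qed.

Lemma smooth_of_strip f : smooth_strip 1 (fun _ => f) -> smooth f.
Proof. intros H; apply (smooth_slice 1 (fun _ => f) 0 H); rewrite Rabs_R0; lra. Qed.

Lemma smooth_plus f g : smooth f -> smooth g -> smooth (fun x => f x + g x).
Proof.
intros Hf Hg; apply smooth_of_strip; intros n.
apply (diff_strip_plus 1 n (fun _ => f) (fun _ => g)); apply smooth_strip_lift; auto.
Qed.

Lemma smooth_mult f g : smooth f -> smooth g -> smooth (fun x => f x * g x).
Proof.
intros Hf Hg; apply smooth_of_strip; intros n.
apply (diff_strip_mult 1 n (fun _ => f) (fun _ => g)); apply smooth_strip_lift; auto.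
Qed.

Lemma smooth_opp f : smooth f -> smooth (fun x => - f x).
Proof.
intros Hf; apply smooth_of_strip; intros n.
apply (diff_strip_opp 1 n (fun _ => f)); apply smooth_strip_lift; auto.
Qed.

Lemma smooth_minus f g : smooth f -> smooth g -> smooth (fun x => f x - g x).
Proof. intros Hf Hg; apply (smooth_plus f); auto using smooth_opp. Qed.

Lemma smooth_inv f : (forall x, f x <> 0) -> smooth f -> smooth (fun x => / f x).
Proof.
intros Hn Hf; apply smooth_of_strip; intros n.
apply (diff_strip_inv 1 n (fun _ => f)); auto; apply smooth_strip_lift; auto.
Qed.

Lemma smooth_sqrt f : (forall x, 0 < f x) -> smooth f -> smooth (fun x => sqrt (f x)).
Proof.
intros Hp Hf; apply smooth_of_strip; intros n.
apply (diff_strip_sqrt 1 n (fun _ => f)); auto; apply smooth_strip_lift; auto.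
Qed.

(** * Periodic functions *)

Lemma periodic_Derive L f : smooth f -> periodic L f -> periodic L (Derive f).
Proof.
intros Hs Hf x.
rewrite <- (Derive_ext (fun t => f (t + L)) f x Hf).
symmetry; apply is_derive_unique.
replace (Derive f (x + L)) with (scal 1 (Derive f (x + L))) by apply Rmult_1_l.
apply (is_derive_comp f (fun t => t + L)); [apply smooth_is_derive, Hs|].
auto_derive; auto; ring.
Qed.

Lemma ex_RInt_of_continuous (f : R -> R) a b :
  (forall x, continuous f x) -> ex_RInt f a b.
Proof. intros H; apply (ex_RInt_continuous (V := R_CompleteNormedModule)); auto. Qed.

(** Integration by parts over a period in the form used throughout: exact
    derivatives of periodic functions do not contribute. *)
Lemma RInt_add_Derive L f g h : smooth h -> h L = h 0 ->
  (forall x, continuous f x) -> (forall x, g x = f x + Derive h x) ->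
  RInt g 0 L = RInt f 0 L.
Proof.
intros Hh Hp Hf Hg.
assert (Hc : forall x, continuous (Derive h) x).
{ intros x; apply smooth_continuous, smooth_Derive, Hh. }
transitivity (RInt (fun x => plus (f x) (Derive h x)) 0 L).
{ apply RInt_ext; intros; apply Hg. }
transitivity (plus (RInt f 0 L) (RInt (Derive h) 0 L)).
{ apply (RInt_plus (V := R_CompleteNormedModule)); apply ex_RInt_of_continuous; auto. }
rewrite RInt_Derive; auto; [|intros; apply smooth_ex_derive, Hh].
rewrite Hp; unfold plus; simpl; ring.
Qed.

Lemma periodic_ends {T} L (f : R -> T) : periodic L f -> f L = f 0.
Proof. intros H; rewrite <- (H 0); f_equal; ring. Qed.

Lemma RInt_periodic L (f : R -> R) a : (forall x, continuous f x) -> periodic L f ->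
  RInt f a (a + L) = RInt f 0 L.
Proof.
intros Hc Hp.
assert (E : forall u v, ex_RInt f u v) by (intros; apply ex_RInt_of_continuous; auto).
assert (S : RInt f L (a + L) = RInt f 0 a).
{ assert (S := RInt_comp_lin (V := R_CompleteNormedModule) f 1 L 0 a (E _ _)).
  replace (1 * 0 + L) with L in S by ring; replace (1 * a + L) with (a + L) in S by ring.
  rewrite <- S; apply RInt_ext; intros x _.
  rewrite Hp; transitivity (f (1 * x)); [apply Rmult_1_l|f_equal; ring]. }
assert (C1 := RInt_Chasles f 0 a (a + L) (E _ _) (E _ _)).
assert (C2 := RInt_Chasles f 0 L (a + L) (E _ _) (E _ _)).
rewrite S in C2; unfold plus in C1, C2; simpl in C1, C2; lra.
Qed.

Lemma periodic_IZR {T} L (f : R -> T) : periodic L f ->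
  forall n x, f (x + IZR n * L) = f x.
Proof.
intros Hf n; induction n as [|n IH|n IH] using Z.peano_ind; intros x.
- f_equal; ring.
- rewrite succ_IZR; transitivity (f (x + IZR n * L + L)); [f_equal; ring|].
  rewrite Hf; apply IH.
- unfold Z.pred; rewrite plus_IZR, <- (Hf (x + _)), <- (IH x); f_equal; simpl; ring.
Qed.

Lemma periodic_bounded L f : 0 < L -> smooth f -> periodic L f ->
  exists B, 0 <= B /\ forall x, Rabs (f x) <= B.
Proof.
intros HL Hs Hf.
destruct (continuity_ab_maj (fun x => Rabs (f x)) 0 L) as [M [HM _]]; [lra| |].
- intros c _; apply (continuity_pt_comp f Rabs); [apply smooth_continuity, Hs|apply Rcontinuity_abs].
- exists (Rabs (f M)); split; [apply Rabs_pos|intros x].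
  destruct (base_Int_part (x / L)) as [A B].
  set (n := Int_part (x / L)) in *.
  assert (E : x = (x - IZR n * L) + IZR n * L) by ring.
  assert (x / L * L = x) by (field; lra).
  rewrite E, (periodic_IZR L f Hf); apply (HM (x - IZR n * L)); nra.
Qed.

(** The primitive of f vanishes at both ends and is monotone, hence it is
    identically zero and so is its derivative f. *)
Lemma RInt_nonneg_zero (f : R -> R) a b x : (forall x, continuous f x) ->
  (forall x, 0 <= f x) -> a < x < b -> RInt f a b = 0 -> f x = 0.
Proof.
intros Hc Hp Hx Hi.
assert (E : forall u v, ex_RInt f u v)
  by (intros; apply ex_RInt_of_continuous; auto).
assert (Z : forall t, a < t < b -> RInt f a t = 0).
{ intros t Ht.
  assert (C := RInt_Chasles f a t b (E _ _) (E _ _)); unfold plus in C; simpl in C.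
  assert (0 <= RInt f a t) by (apply RInt_ge_0; auto; lra).
  assert (0 <= RInt f t b) by (apply RInt_ge_0; auto; lra).
  lra. }
assert (D : is_derive (RInt f a) x (f x)).
{ apply (is_derive_RInt (V := R_CompleteNormedModule) f (RInt f a) a x); auto.
  apply filter_forall; intros y; apply (RInt_correct (V := R_CompleteNormedModule)), E. }
rewrite <- (is_derive_unique _ _ _ D).
rewrite (Derive_ext_loc _ (fun _ => 0)); [apply Derive_const|].
assert (Hr : 0 < Rmin (x - a) (b - x)) by (apply Rmin_pos; lra).
exists (mkposreal _ Hr); intros y Hy.
change (Rabs (y - x) < Rmin (x - a) (b - x)) in Hy.
apply Z; apply Rabs_def2 in Hy.
assert (H1 := Rmin_l (x - a) (b - x)); assert (H2 := Rmin_r (x - a) (b - x)); lra.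
Qed.

(** Shifting the period so that x is interior avoids a separate discussion of the
    end points. *)
Lemma periodic_sq_RInt_zero L f : 0 < L -> (forall x, continuous f x) -> periodic L f ->
  RInt (fun x => f x * f x) 0 L = 0 -> forall x, f x = 0.
Proof.
intros HL Hc Hp Hi x.
assert (Hc2 : forall x, continuous (fun x => f x * f x) x).
{ intros; apply (continuous_mult f f); auto. }
assert (E : f x * f x = 0).
{ apply (RInt_nonneg_zero (fun x => f x * f x) (x - L / 2) (x - L / 2 + L)); auto.
  - intros; apply Rle_0_sqr.
  - lra.
  - rewrite RInt_periodic; auto; intros y; now rewrite Hp. }
nra.
Qed.

Lemma derive_zero_constant f : smooth f -> (forall x, Derive f x = 0) -> forall x, f x = f 0.
Proof.
intros Sf Hf x.
assert (D : forall t, is_derive f t zero).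
{ intros t; change (is_derive f t 0); rewrite <- (Hf t); apply smooth_is_derive, Sf. }
destruct (Rtotal_order x 0) as [H|[->|H]]; auto.
- apply (eq_is_derive f x 0); auto.
- symmetry; apply (eq_is_derive f 0 x); auto.
Qed.

(** Integration by parts turns the pairing of rho'' with rho into minus the squared
    L2 norm of rho'. *)
Lemma constant_of_orthogonal L rho : 0 < L -> smooth rho -> periodic L rho ->
  RInt (fun x => Derive (Derive rho) x * rho x) 0 L = 0 -> forall x, rho x = rho 0.
Proof.
intros HL Sr Pr H; apply derive_zero_constant; auto.
assert (S1 := smooth_Derive _ Sr); assert (S2 := smooth_Derive _ S1).
assert (P1 := periodic_Derive L rho Sr Pr).
apply (periodic_sq_RInt_zero L); auto.
{ intros; apply smooth_continuous, S1. }
assert (E : RInt (fun x => Derive (Derive rho) x * rho x) 0 L =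
  RInt (fun x => - (Derive rho x * Derive rho x)) 0 L).
{ apply (RInt_add_Derive L _ _ (fun x => Derive rho x * rho x)).
  - apply smooth_mult; auto.
  - now rewrite (periodic_ends L _ P1), (periodic_ends L _ Pr).
  - intros x; apply (smooth_continuous (fun x => - (Derive rho x * Derive rho x))).
    apply smooth_opp, smooth_mult; auto.
  - intros x; rewrite Derive_mult by (apply smooth_ex_derive; auto); ring. }
assert (O := RInt_opp (V := R_CompleteNormedModule) (fun x => Derive rho x * Derive rho x) 0 L).
change (ex_RInt (fun x => Derive rho x * Derive rho x) 0 L ->
  RInt (fun x => - (Derive rho x * Derive rho x)) 0 L =
  - RInt (fun x => Derive rho x * Derive rho x) 0 L) in O.
rewrite H, O in E; [lra|].
apply ex_RInt_of_continuous; intros x.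
apply smooth_continuous, smooth_mult; auto.
Qed.

(** * Hermitian algebra of C^2 *)

Lemma hdot_add_l z w u : hdot (addC2 z w) u = Cplus (hdot z u) (hdot w u).
Proof. unfold hdot, addC2; simpl; ring. Qed.
Lemma hdot_add_r z w u : hdot u (addC2 z w) = Cplus (hdot u z) (hdot u w).
Proof. unfold hdot, addC2; simpl; rewrite !Cplus_conj; ring. Qed.
Lemma hdot_scale_l a z w : hdot (scaleC2 a z) w = Cmult a (hdot z w).
Proof. unfold hdot, scaleC2; simpl; ring. Qed.
Lemma hdot_scale_r a z w : hdot z (scaleC2 a w) = Cmult (Cconj a) (hdot z w).
Proof. unfold hdot, scaleC2; simpl; rewrite !Cmult_conj; ring. Qed.
Lemma hdot_conj z w : hdot w z = Cconj (hdot z w).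
Proof. unfold hdot; rewrite Cplus_conj, !Cmult_conj, !Cconj_conj; ring. Qed.

Ltac c2_coords :=
  unfold frame_field, hnorm2, addC2, subC2, iC2, scaleC2, hdot, coord, RtoC, Ci in *;
  repeat match goal with z : C2 |- _ => destruct z as [[? ?] [? ?]] end; simpl in *.

Lemma hdot_self z : hdot z z = RtoC (hnorm2 z).
Proof. c2_coords; apply injective_projections; simpl; ring. Qed.

Lemma hnorm2_pos z : z <> (RtoC 0, RtoC 0) -> 0 < hnorm2 z.
Proof.
intros Hz; destruct z as [[a b] [c d]].
replace (hnorm2 _) with (a * a + b * b + (c * c + d * d))
  by (unfold hnorm2, hdot; simpl; ring).
destruct (Rtotal_order 0 (a * a + b * b + (c * c + d * d))) as [H|[H|H]]; auto; [|nra].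
exfalso; apply Hz.
assert (a = 0) by nra; assert (b = 0) by nra; assert (c = 0) by nra; assert (d = 0) by nra.
now subst.
Qed.

Lemma C2_ext z w : (forall j, coord z j = coord w j) -> z = w.
Proof.
intros H.
assert (H0 := H 0%nat); assert (H1 := H 1%nat);
assert (H2 := H 2%nat); assert (H3 := H 3%nat).
c2_coords; now subst.
Qed.

Lemma coord_add z w j : coord (addC2 z w) j = coord z j + coord w j.
Proof. c2_coords; destruct j as [|[|[|[|j]]]]; simpl; try ring; destruct j; ring. Qed.
Lemma coord_scale a z j : coord (scaleC2 (RtoC a) z) j = a * coord z j.
Proof. c2_coords; destruct j as [|[|[|[|j]]]]; simpl; try ring; destruct j; ring. Qed.

(** Multiplication by i permutes the real coordinates up to sign. *)
Lemma coord_i z j : coord (iC2 z) j =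
  match j with
  | 0%nat => - coord z 1 | 1%nat => coord z 0
  | 2%nat => - coord z 3 | 3%nat => coord z 2
  | _ => 0 end.
Proof. c2_coords; destruct j as [|[|[|[|j]]]]; simpl; try ring; destruct j; ring. Qed.

Lemma coord_high z j : coord z (S (S (S (S j)))) = 0.
Proof. c2_coords; destruct j; ring. Qed.

Lemma coord_sub z w j : coord (subC2 z w) j = coord z j - coord w j.
Proof. c2_coords; destruct j as [|[|[|[|j]]]]; simpl; try ring; destruct j; ring. Qed.

Lemma hdot_sub_l z w u : hdot (subC2 z w) u = Cminus (hdot z u) (hdot w u).
Proof. unfold hdot, subC2; simpl; ring. Qed.

(** The real part is the Euclidean product of the coordinates, and the imaginary
    part is the pairing with i w. *)
Lemma hdot_coords z w : hdot z w =
  (coord z 0 * coord w 0 + coord z 1 * coord w 1 + coord z 2 * coord w 2 + coord z 3 * coord w 3,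
   coord z 1 * coord w 0 - coord z 0 * coord w 1 + coord z 3 * coord w 2 - coord z 2 * coord w 3).
Proof. c2_coords; repeat apply injective_projections; simpl; ring. Qed.

Lemma hnorm2_scale_real a z : hnorm2 (scaleC2 (RtoC a) z) = a * a * hnorm2 z.
Proof. unfold hnorm2; rewrite hdot_scale_l, hdot_scale_r; simpl; ring. Qed.

Definition rot (t : R) (z : C2) : C2 := scaleC2 (cos t, sin t) z.

Lemma rot_real t z :
  rot t z = addC2 (scaleC2 (RtoC (cos t)) z) (scaleC2 (RtoC (sin t)) (iC2 z)).
Proof. unfold rot; c2_coords; repeat apply injective_projections; simpl; ring. Qed.

Lemma hdot_rot t z w : hdot (rot t z) (rot t w) = hdot z w.
Proof.
unfold rot; rewrite hdot_scale_l, hdot_scale_r.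
replace (hdot z w) with (Cmult (RtoC (Rsqr (sin t) + Rsqr (cos t))) (hdot z w)) at 2
  by (rewrite sin2_cos2; ring).
rewrite Cmult_assoc; f_equal; unfold Rsqr; apply injective_projections; simpl; ring.
Qed.

Lemma rot_inj0 t z : rot t z = (RtoC 0, RtoC 0) -> z = (RtoC 0, RtoC 0).
Proof.
intros H.
assert (E : hnorm2 z = 0).
{ unfold hnorm2; rewrite <- (hdot_rot t), H; unfold hdot; simpl; ring. }
destruct (Classical_Prop.classic (z = (RtoC 0, RtoC 0))) as [|N]; auto.
apply hnorm2_pos in N; lra.
Qed.

(** * The determinant in the frame *)

Module Determinant.
Import ssreflect ssrfun ssrbool fintype ssralg matrix bigop Rstruct.
(** Entries are indexed by natural numbers, so that the submatrices met when
    expanding row by row are again of this shape and their indices compute. *)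
Definition minor n (f : nat -> nat -> R) : R :=
  determinant (\matrix_(i < n, j < n) f i j).

Lemma minorS n f :
  minor (S n) f = (\sum_(j < S n) (f 0%nat j * ((-1) ^+ j *
     minor n (fun i k => f (S i) (bump j k)))))%R.
Proof.
rewrite /minor (expand_det_row _ ord0); apply: eq_bigr => j _.
rewrite /cofactor mxE; congr (_ * (_ * _))%R; congr determinant.
by apply/matrixP => i k; rewrite !mxE.
Qed.

(** Laplace expansion along the first two columns. *)
Lemma detR_expand a b c d : detR a b c d =
  let m2 i j k l := (coord a i * coord b j - coord a j * coord b i) *
                    (coord c k * coord d l - coord c l * coord d k) in
  m2 0%nat 1%nat 2%nat 3%nat - m2 0%nat 2%nat 1%nat 3%nat + m2 0%nat 3%nat 1%nat 2%nat
  + m2 1%nat 2%nat 0%nat 3%nat - m2 1%nat 3%nat 0%nat 2%nat + m2 2%nat 3%nat 0%nat 1%nat.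
Proof.
rewrite -[detR _ _ _ _]/(minor 4 (fun i j => coord (List.nth j (a :: b :: c :: d :: nil) a) i)) minorS.
do 3 rewrite !big_ord_recl big_ord0 !minorS.
rewrite !big_ord_recl !big_ord0 /minor !det_mx00.
cbn -[coord GRing.add GRing.mul GRing.opp GRing.zero GRing.one GRing.exp Rplus Rmult Ropp].
rewrite /bump /=.
rewrite ?GRing.Theory.exprS ?GRing.Theory.expr0 -?RplusE -?RoppE -?RmultE -?R1E -?R0E.
ring.
Qed.
End Determinant.

(** The real determinant of a, b, i b, i a is the complex Gram determinant
    |a|^2 |b|^2 - |<b,a>|^2, and the multiples of b in the last two columns are
    absorbed by the second one. *)
Lemma detR_frame a b p1 q1 r1 p2 q2 r2 :
  hdot a a = RtoC 1 -> hdot b a = RtoC 0 ->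
  let f p q r := addC2 (scaleC2 (RtoC p) b)
    (addC2 (scaleC2 (RtoC q) (iC2 b)) (scaleC2 (RtoC r) (iC2 a))) in
  detR a b (f p1 q1 r1) (f p2 q2 r2) = (q1 * r2 - r1 * q2) * hnorm2 b.
Proof.
intros Ha Hb f.
replace (detR _ _ _ _) with ((q1 * r2 - r1 * q2) *
  (Re (hdot a a) * hnorm2 b - (Re (hdot b a) * Re (hdot b a) + Im (hdot b a) * Im (hdot b a)))).
- rewrite Ha, Hb; simpl; ring.
- clear Ha Hb; unfold f; clear f; rewrite Determinant.detR_expand; cbv beta zeta.
  rewrite !coord_add, !coord_scale, !coord_i; unfold hnorm2; rewrite !hdot_coords; simpl Re; simpl Im.
  generalize (coord a 0) (coord a 1) (coord a 2) (coord a 3)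
    (coord b 0) (coord b 1) (coord b 2) (coord b 3).
  intros; ring.
Qed.

(** * Differentiation of curves in C^2 *)

(** Real coordinates make the calculus of curves a consequence of the rules for
    real functions. *)
Definition is_derC2 (g : R -> C2) (x : R) (v : C2) : Prop :=
  forall j, is_derive (fun t => coord (g t) j) x (coord v j).

Lemma is_derC2_unique g x v : is_derC2 g x v -> DerC2 g x = v.
Proof.
intros H; unfold DerC2, DerC.
destruct v as [[? ?] [? ?]]; repeat apply injective_projections; simpl; apply is_derive_unique;
  [exact (H 0%nat)|exact (H 1%nat)|exact (H 2%nat)|exact (H 3%nat)].
Qed.

Lemma coord_DerC2 g x j : coord (DerC2 g x) j = Derive (fun t => coord (g t) j) x.
Proof.
destruct j as [|[|[|[|j]]]]; try reflexivity.
rewrite coord_high; symmetry.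
rewrite (Derive_ext _ (fun _ => 0)); [apply Derive_const|].
intros; apply coord_high.
Qed.

Lemma smoothC2_is_derC2 g x : smoothC2 g -> is_derC2 g x (DerC2 g x).
Proof. intros H j; rewrite coord_DerC2; apply smooth_is_derive, H. Qed.

Lemma smoothC2_DerC2 g : smoothC2 g -> smoothC2 (DerC2 g).
Proof.
intros H j; apply (smooth_ext (Derive (fun t => coord (g t) j))).
- intros x; symmetry; apply coord_DerC2.
- apply smooth_Derive, H.
Qed.

Lemma is_derC2_ext g h x v : (forall t, g t = h t) -> is_derC2 g x v -> is_derC2 h x v.
Proof.
intros E H j; apply (is_derive_ext (fun t => coord (g t) j)); auto.
intros t; now rewrite E.
Qed.

Lemma is_derC2_add g h x v w : is_derC2 g x v -> is_derC2 h x w ->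
  is_derC2 (fun t => addC2 (g t) (h t)) x (addC2 v w).
Proof.
intros Hg Hh j; rewrite coord_add.
apply (is_derive_ext (fun t => coord (g t) j + coord (h t) j)).
- intros; symmetry; apply coord_add.
- apply (is_derive_plus (V := R_NormedModule)); auto.
Qed.

Lemma is_derC2_scale f g x l v : is_derive f x l -> is_derC2 g x v ->
  is_derC2 (fun t => scaleC2 (RtoC (f t)) (g t)) x
    (addC2 (scaleC2 (RtoC l) (g x)) (scaleC2 (RtoC (f x)) v)).
Proof.
intros Hf Hg j; rewrite coord_add, !coord_scale.
apply (is_derive_ext (fun t => f t * coord (g t) j)).
- intros; symmetry; apply coord_scale.
- apply (is_derive_mult f (fun t => coord (g t) j)); auto; exact Rmult_comm.
Qed.

Lemma is_derC2_i g x v : is_derC2 g x v -> is_derC2 (fun t => iC2 (g t)) x (iC2 v).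
Proof.
intros Hg j; rewrite coord_i.
eapply is_derive_ext; [intros t; symmetry; apply coord_i|].
destruct j as [|[|[|[|j]]]]; auto.
- apply (is_derive_opp (V := R_NormedModule)); auto.
- apply (is_derive_opp (V := R_NormedModule)); auto.
- apply (is_derive_const (V := R_NormedModule)).
Qed.

Lemma is_derC2_comp g f x l v : is_derive f x l -> is_derC2 g (f x) v ->
  is_derC2 (fun t => g (f t)) x (scaleC2 (RtoC l) v).
Proof.
intros Hf Hg j; rewrite coord_scale.
apply (is_derive_comp (fun t => coord (g t) j) f); auto.
Qed.

(** The derivative is kept inside the rotation, which is unitary and therefore
    disappears from every Hermitian product between the curve and its velocity. *)
Lemma is_derC2_rot f g x l v : is_derive f x l -> is_derC2 g x v ->
  is_derC2 (fun t => rot (f t) (g t)) x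
    (rot (f x) (addC2 v (scaleC2 (RtoC l) (iC2 (g x))))).
Proof.
intros Hf Hg.
apply (is_derC2_ext (fun t => addC2 (scaleC2 (RtoC (cos (f t))) (g t))
                                    (scaleC2 (RtoC (sin (f t))) (iC2 (g t))))).
{ intros; symmetry; apply rot_real. }
replace (rot _ _) with
  (addC2 (addC2 (scaleC2 (RtoC (l * - sin (f x))) (g x)) (scaleC2 (RtoC (cos (f x))) v))
     (addC2 (scaleC2 (RtoC (l * cos (f x))) (iC2 (g x))) (scaleC2 (RtoC (sin (f x))) (iC2 v)))).
- apply is_derC2_add.
  + apply (is_derC2_scale (fun t => cos (f t))); auto.
    apply (is_derive_comp cos f); auto; apply is_derive_cos.
  + apply (is_derC2_scale (fun t => sin (f t)) (fun t => iC2 (g t))); auto using is_derC2_i.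
    apply (is_derive_comp sin f); auto; apply is_derive_sin.
- rewrite rot_real; generalize (g x) (cos (f x)) (sin (f x)); intros; clear.
  c2_coords; repeat apply injective_projections; simpl; ring.
Qed.

Lemma is_derive_hdot g h x v w : is_derC2 g x v -> is_derC2 h x w ->
  is_derive (fun t => Re (hdot (g t) (h t))) x (Re (Cplus (hdot v (h x)) (hdot (g x) w))) /\
  is_derive (fun t => Im (hdot (g t) (h t))) x (Im (Cplus (hdot v (h x)) (hdot (g x) w))).
Proof.
intros Hg Hh.
assert (P : forall i j, is_derive (fun t => coord (g t) i * coord (h t) j) x
   (coord v i * coord (h x) j + coord (g x) i * coord w j)).
{ intros i j; apply (is_derive_mult (fun t => coord (g t) i) (fun t => coord (h t) j)); auto.
  exact Rmult_comm. }
assert (A : forall F G (a b : R), is_derive F x a -> is_derive G x b ->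
  is_derive (fun t => F t + G t) x (a + b)) by (intros; apply (is_derive_plus F G x); auto).
assert (B : forall F G (a b : R), is_derive F x a -> is_derive G x b ->
  is_derive (fun t => F t - G t) x (a - b)) by (intros; apply (is_derive_minus F G x); auto).
split; eapply is_derive_ext; try (intros t; symmetry; rewrite hdot_coords; simpl; reflexivity);
 rewrite !hdot_coords; simpl.
- match goal with |- is_derive _ _ ?l => replace l with
   (coord v 0 * coord (h x) 0 + coord (g x) 0 * coord w 0 +
    (coord v 1 * coord (h x) 1 + coord (g x) 1 * coord w 1) +
    (coord v 2 * coord (h x) 2 + coord (g x) 2 * coord w 2) +
    (coord v 3 * coord (h x) 3 + coord (g x) 3 * coord w 3)) by ring end.
  auto 6.
- match goal with |- is_derive _ _ ?l => replace l with
   (coord v 1 * coord (h x) 0 + coord (g x) 1 * coord w 0 -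
    (coord v 0 * coord (h x) 1 + coord (g x) 0 * coord w 1) +
    (coord v 3 * coord (h x) 2 + coord (g x) 3 * coord w 2) -
    (coord v 2 * coord (h x) 3 + coord (g x) 2 * coord w 3)) by ring end.
  auto 6.
Qed.
Lemma smooth_hdot g h : smoothC2 g -> smoothC2 h ->
  smooth (fun x => Re (hdot (g x) (h x))) /\ smooth (fun x => Im (hdot (g x) (h x))).
Proof.
intros Hg Hh.
assert (M : forall i j, smooth (fun x => coord (g x) i * coord (h x) j)).
{ intros i j; apply smooth_mult; [apply Hg|apply Hh]. }
split.
- apply (smooth_ext (fun x => coord (g x) 0 * coord (h x) 0 + coord (g x) 1 * coord (h x) 1 +
    coord (g x) 2 * coord (h x) 2 + coord (g x) 3 * coord (h x) 3)).
  + intros x; now rewrite hdot_coords.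
  + auto using smooth_plus.
- apply (smooth_ext (fun x => coord (g x) 1 * coord (h x) 0 - coord (g x) 0 * coord (h x) 1 +
    coord (g x) 3 * coord (h x) 2 - coord (g x) 2 * coord (h x) 3)).
  + intros x; now rewrite hdot_coords.
  + apply smooth_minus; [apply smooth_plus; [apply smooth_minus|]|]; auto.
Qed.

Lemma periodic_DerC2 L g : smoothC2 g -> periodic L g -> periodic L (DerC2 g).
Proof.
intros Hs Hg x; apply C2_ext; intros j; rewrite !coord_DerC2.
apply (periodic_Derive L (fun t => coord (g t) j)); [apply Hs|].
intros y; now rewrite (Hg y).
Qed.

Definition smooth_stripC2 (d : R) (Z : R -> R -> C2) : Prop :=
  forall j, smooth_strip d (fun e x => coord (Z e x) j).

Lemma smooth_stripC2_add d Z W : smooth_stripC2 d Z -> smooth_stripC2 d W ->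
  smooth_stripC2 d (fun e x => addC2 (Z e x) (W e x)).
Proof.
intros HZ HW j n.
apply (diff_strip_ext d n (fun e x => coord (Z e x) j + coord (W e x) j)).
- intros; symmetry; apply coord_add.
- apply diff_strip_plus; [apply HZ|apply HW].
Qed.

Lemma smooth_stripC2_scale d f Z : smooth_strip d f -> smooth_stripC2 d Z ->
  smooth_stripC2 d (fun e x => scaleC2 (RtoC (f e x)) (Z e x)).
Proof.
intros Hf HZ j n.
apply (diff_strip_ext d n (fun e x => f e x * coord (Z e x) j)).
- intros; symmetry; apply coord_scale.
- apply diff_strip_mult; [apply Hf|apply HZ].
Qed.

Lemma smooth_stripC2_i d Z : smooth_stripC2 d Z -> smooth_stripC2 d (fun e x => iC2 (Z e x)).
Proof.
intros HZ j n.
eapply diff_strip_ext; [intros; symmetry; apply coord_i|].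
destruct j as [|[|[|[|j]]]].
- apply (diff_strip_opp d n (fun e x => coord (Z e x) 1)), HZ.
- apply HZ.
- apply (diff_strip_opp d n (fun e x => coord (Z e x) 3)), HZ.
- apply HZ.
- apply diff_strip_const.
Qed.

Lemma smooth_stripC2_ext d Z W : (forall e x, Z e x = W e x) ->
  smooth_stripC2 d Z -> smooth_stripC2 d W.
Proof.
intros E HZ j n; apply (diff_strip_ext d n (fun e x => coord (Z e x) j)); [|apply HZ].
intros; now rewrite E.
Qed.

Lemma smooth_stripC2_rot d f Z : smooth_strip d f -> smooth_stripC2 d Z ->
  smooth_stripC2 d (fun e x => rot (f e x) (Z e x)).
Proof.
intros Hf HZ.
apply (smooth_stripC2_ext d (fun e x => addC2 (scaleC2 (RtoC (cos (f e x))) (Z e x))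
   (scaleC2 (RtoC (sin (f e x))) (iC2 (Z e x))))).
{ intros; symmetry; apply rot_real. }
apply smooth_stripC2_add.
- apply (smooth_stripC2_scale d (fun e x => cos (f e x))); auto.
  intros n; apply (diff_strip_sin_cos d n f (Hf n)).
- apply (smooth_stripC2_scale d (fun e x => sin (f e x)) (fun e x => iC2 (Z e x)));
    auto using smooth_stripC2_i.
  intros n; apply (diff_strip_sin_cos d n f (Hf n)).
Qed.

(** * The symplectic form in the Legendrian frame *)

(** The numerator of the curvature; it equals k |g_x|^3. *)
Definition speed_rotation (g : R -> C2) (x : R) : R :=
  Im (hdot (DerC2 (DerC2 g) x) (DerC2 g x)).

Section Legendrian.
Variable g : R -> C2.
Hypothesis Hg : regular_legendrian g.

Lemma speed2_pos x : 0 < speed2 g x.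
Proof. apply hnorm2_pos, Hg. Qed.

Lemma smooth_speed2 : smooth (speed2 g).
Proof.
assert (H := smoothC2_DerC2 _ (rl_smooth _ Hg)).
apply (smooth_hdot _ _ H H).
Qed.

Lemma smooth_speed_rotation : smooth (speed_rotation g).
Proof.
assert (H := smoothC2_DerC2 _ (rl_smooth _ Hg)).
apply (smooth_hdot _ _ (smoothC2_DerC2 _ H) H).
Qed.

(** Differentiate <g_x,g> = 0 and <g_x,g_x> = s.  The second relation determines
    the real part of <g_xx,g_x> only. *)
Lemma legendrian_hdot_xx x :
  hdot (DerC2 (DerC2 g) x) (g x) = RtoC (- speed2 g x) /\
  hdot (DerC2 (DerC2 g) x) (DerC2 g x) = (Derive (speed2 g) x / 2, speed_rotation g x).
Proof.
assert (S1 := rl_smooth _ Hg).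
assert (D1 := smoothC2_is_derC2 _ x S1).
assert (D2 := smoothC2_is_derC2 _ x (smoothC2_DerC2 _ S1)).
split.
- destruct (is_derive_hdot _ _ _ _ _ D2 D1) as [A B].
  apply (is_derive_ext _ (fun _ => 0)) in A;
    [|intros t; now rewrite (rl_legendrian _ Hg)].
  apply (is_derive_ext _ (fun _ => 0)) in B;
    [|intros t; now rewrite (rl_legendrian _ Hg)].
  apply is_derive_unique in A; apply is_derive_unique in B.
  rewrite Derive_const in A, B; rewrite (hdot_self (DerC2 g x)) in A, B.
  fold (speed2 g x) in A, B; simpl in A, B.
  apply injective_projections; simpl; unfold Re, Im in *; lra.
- destruct (is_derive_hdot _ _ _ _ _ D2 D2) as [A _].
  apply is_derive_unique in A.
  change (Derive (speed2 g) x = Re (Cplus (hdot (DerC2 (DerC2 g) x) (DerC2 g x))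
                                          (hdot (DerC2 g x) (DerC2 (DerC2 g) x)))) in A.
  rewrite (hdot_conj (DerC2 (DerC2 g) x) (DerC2 g x)) in A.
  apply injective_projections; [|reflexivity].
  rewrite A; simpl; unfold Re; field.
Qed.

Lemma legendrian_hdot_x_l x : hdot (g x) (DerC2 g x) = RtoC 0.
Proof. rewrite hdot_conj, (rl_legendrian _ Hg); apply injective_projections; simpl; ring. Qed.

Lemma curvature_eq x : curvature g x = speed_rotation g x / (speed2 g x * sqrt (speed2 g x)).
Proof.
unfold curvature; f_equal.
replace (3 / 2) with (1 + / 2) by field.
now rewrite Rpower_plus, Rpower_1, Rpower_sqrt by apply speed2_pos.
Qed.

Lemma smooth_curvature : smooth (curvature g).
Proof.
apply (smooth_ext (fun x => speed_rotation g x * / (speed2 g x * sqrt (speed2 g x)))).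
{ intros; symmetry; apply curvature_eq. }
apply smooth_mult; [apply smooth_speed_rotation|].
apply smooth_inv.
- intros x; assert (H := speed2_pos x); assert (H' := sqrt_lt_R0 _ H); nra.
- apply smooth_mult; [apply smooth_speed2|].
  apply smooth_sqrt; [exact speed2_pos|apply smooth_speed2].
Qed.

(** The coefficient r is intrinsic to the vector field, being its contact
    component. *)
Lemma frame_field_r p q r x : Im (hdot (frame_field g p q r x) (g x)) = r x.
Proof.
unfold frame_field, iC2; rewrite !hdot_add_l, !hdot_scale_l, (rl_legendrian _ Hg), (rl_sphere _ Hg).
simpl; ring.
Qed.

(** The two tangency conditions turn the density (q1 r2 - r1 q2) s into
    (r1' r2 - r1 r2') / 2, which differs from r1' r2 by the derivative of
    r1 r2 / 2. *)
Lemma Omega_frame L p1 q1 r1 p2 q2 r2 :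
  smooth r1 -> smooth r2 -> r1 L = r1 0 -> r2 L = r2 0 ->
  (forall x, Derive r1 x = 2 * q1 x * speed2 g x) ->
  (forall x, Derive r2 x = 2 * q2 x * speed2 g x) ->
  Omega L g (frame_field g p1 q1 r1) (frame_field g p2 q2 r2) =
  - RInt (fun x => Derive r1 x * r2 x) 0 L.
Proof.
intros S1 S2 E1 E2 D1 D2; unfold Omega; f_equal.
apply (RInt_add_Derive L _ _ (fun x => - / 2 * (r1 x * r2 x))).
- apply smooth_mult; [apply smooth_const|apply smooth_mult; auto].
- rewrite E1, E2; reflexivity.
- intros x; apply smooth_continuous, smooth_mult; auto using smooth_Derive.
- intros x; unfold frame_field.
  rewrite (detR_frame (g x) (DerC2 g x) _ _ _ _ _ _ (rl_sphere _ Hg x) (rl_legendrian _ Hg x)).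
  rewrite Derive_scal, Derive_mult by (apply smooth_ex_derive; auto).
  rewrite D1, D2; unfold speed2; field.
Qed.
End Legendrian.

Lemma periodic_speed2 L g : P_space L g -> periodic L (speed2 g).
Proof.
intros [Hg Hp] x; unfold speed2; now rewrite (periodic_DerC2 L g (rl_smooth _ Hg) Hp x).
Qed.

Lemma periodic_speed_rotation L g : P_space L g -> periodic L (speed_rotation g).
Proof.
intros [Hg Hp] x; unfold speed_rotation.
assert (H := rl_smooth _ Hg); assert (H' := periodic_DerC2 L g H Hp).
now rewrite H', (periodic_DerC2 L _ (smoothC2_DerC2 _ H) H').
Qed.

Lemma periodic_curvature L g : P_space L g -> periodic L (curvature g).
Proof.
intros Hg x; rewrite !curvature_eq by apply Hg.
now rewrite (periodic_speed2 L g Hg), (periodic_speed_rotation L g Hg).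
Qed.

(** * Invariance of arclength *)

Lemma is_derC2_rot_comp t phi g x l : is_derive phi x l -> smoothC2 g ->
  is_derC2 (fun y => rot t (g (phi y))) x (rot t (scaleC2 (RtoC l) (DerC2 g (phi x)))).
Proof.
intros Hp Hg.
replace (rot t _) with (rot t (addC2 (scaleC2 (RtoC l) (DerC2 g (phi x)))
  (scaleC2 (RtoC 0) (iC2 (g (phi x)))))).
- apply (is_derC2_rot (fun _ => t) (fun y => g (phi y))).
  + apply (is_derive_const (V := R_NormedModule)).
  + apply (is_derC2_comp g phi); [exact Hp|apply smoothC2_is_derC2, Hg].
- f_equal; apply C2_ext; intros j; rewrite coord_add, (coord_scale 0); ring.
Qed.

Lemma smooth_arclength_density g : regular_legendrian g -> smooth (fun x => sqrt (speed2 g x)).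
Proof.
intros Hg; apply smooth_sqrt; [apply speed2_pos, Hg|apply smooth_speed2, Hg].
Qed.

(** A rotation is an isometry, a reparametrization is a change of variables, and
    the image interval is a period that may start anywhere. *)
Lemma arclength_functional L : functional_on_Q L (arclength L).
Proof.
intros g h Hg _ (t & phi & Sp & Pp & Lp & Hh).
assert (Sg := rl_smooth _ (proj1 Hg)).
assert (Hc : forall x, continuous (fun x => sqrt (speed2 g x)) x).
{ intros x; apply smooth_continuous, smooth_arclength_density, Hg. }
unfold arclength.
transitivity (RInt (fun x => sqrt (speed2 g x)) (phi 0) (phi L)).
- replace (phi L) with (phi 0 + L) by (rewrite <- Lp; f_equal; ring).
  symmetry; apply RInt_periodic; auto.
  intros x; now rewrite (periodic_speed2 L g Hg).
- rewrite <- (RInt_comp (fun x => sqrt (speed2 g x)) phi (Derive phi)).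
  + apply RInt_ext; intros x _.
    assert (E : DerC2 h x = rot t (scaleC2 (RtoC (Derive phi x)) (DerC2 g (phi x)))).
    { apply is_derC2_unique.
      apply (is_derC2_ext (fun y => rot t (g (phi y)))); [intros; symmetry; apply Hh|].
      apply is_derC2_rot_comp; auto using smooth_is_derive. }
    unfold speed2 at 2; rewrite E; unfold hnorm2; rewrite hdot_rot.
    fold (hnorm2 (scaleC2 (RtoC (Derive phi x)) (DerC2 g (phi x)))).
    rewrite hnorm2_scale_real, sqrt_mult_alt, sqrt_square; [reflexivity| |].
    * left; apply Pp.
    * apply Rle_0_sqr.
  + intros; apply Hc.
  + intros x _; split; [apply smooth_is_derive, Sp|].
    apply smooth_continuous, smooth_Derive, Sp.
Qed.

(** * First variation of arclength *)

Lemma speed2_sum h x : speed2 h x =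
  coord (DerC2 h x) 0 * coord (DerC2 h x) 0 + coord (DerC2 h x) 1 * coord (DerC2 h x) 1 +
  coord (DerC2 h x) 2 * coord (DerC2 h x) 2 + coord (DerC2 h x) 3 * coord (DerC2 h x) 3.
Proof. unfold speed2, hnorm2; now rewrite hdot_coords. Qed.

Section FirstVariation.
Variables (L d : R) (g V : R -> C2) (G : R -> R -> C2).
Hypothesis Hd : 0 < d.
Hypothesis G0 : forall x, G 0 x = g x.
Hypothesis GV : forall x, DerC2 (fun e => G e x) 0 = V x.
Hypothesis GP : forall e, Rabs e < d -> P_space L (G e).
Hypothesis GS : forall j, smooth_strip d (fun e x => coord (G e x) j).

Let H0 : Rabs 0 < d.
Proof. rewrite Rabs_R0; exact Hd. Qed.

Let w j := partial_x (fun e x => coord (G e x) j).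

Let w_smooth j : smooth_strip d (w j).
Proof. intros n; apply (diff_strip_elim d n _ (GS j (S n))). Qed.

Let speed_eq e x : speed2 (G e) x =
  w 0%nat e x * w 0%nat e x + w 1%nat e x * w 1%nat e x +
  w 2%nat e x * w 2%nat e x + w 3%nat e x * w 3%nat e x.
Proof. now rewrite speed2_sum, !coord_DerC2. Qed.

Let speed_smooth : smooth_strip d (fun e x => speed2 (G e) x).
Proof.
intros n; eapply diff_strip_ext; [intros; symmetry; apply speed_eq|].
assert (H := fun j => w_smooth j n).
repeat apply diff_strip_plus; apply diff_strip_mult; apply H.
Qed.

Let speed_pos e x : Rabs e < d -> 0 < speed2 (G e) x.
Proof. intros He; apply speed2_pos, GP, He. Qed.

Let density_smooth : smooth_strip d (fun e x => sqrt (speed2 (G e) x)).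
Proof.
intros n; apply (diff_strip_sqrt d n (fun e x => speed2 (G e) x)); auto.
Qed.

Lemma is_derive_arclength :
  is_derive (fun e => arclength L (G e)) 0
    (RInt (partial_e (fun e x => sqrt (speed2 (G e) x)) 0) 0 L).
Proof.
destruct (diff_strip_elim d 0 _ (density_smooth 1%nat)) as (C & D & D' & C' & _).
apply (is_derive_RInt_param (fun e x => sqrt (speed2 (G e) x)) 0 L 0).
- eapply filter_imp; [|apply (strip_open d 0 H0)].
  intros e He x _; eexists; exact (D e x He).
- intros x _; exact (diff_strip_cont d 0 _ 0 x C' H0).
- eapply filter_imp; [|apply (strip_open d 0 H0)].
  intros e He; apply ex_RInt_of_continuous; intros x.
  apply (ex_derive_continuous (fun x => sqrt (speed2 (G e) x))).
  eexists; exact (D' e x He).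
Qed.

(** The derivative in e of the velocity of the curves is the derivative in x of
    the variation field, by symmetry of the mixed partial derivatives. *)
Lemma partial_e_density x :
  partial_e (fun e x => sqrt (speed2 (G e) x)) 0 x =
  Re (hdot (DerC2 V x) (DerC2 g x)) / sqrt (speed2 g x).
Proof.
assert (Ew : forall j, w j 0 x = coord (DerC2 g x) j).
{ intros j; rewrite coord_DerC2; apply Derive_ext; intros; now rewrite G0. }
assert (Dw : forall j, is_derive (fun e => w j e x) 0 (coord (DerC2 V x) j)).
{ intros j.
  destruct (diff_strip_elim d 0 _ (w_smooth j 1%nat)) as (_ & D & _).
  replace (coord (DerC2 V x) j) with (partial_e (w j) 0 x); [exact (D 0 x H0)|].
  unfold w; rewrite (mixed_partials d (fun e x => coord (G e x) j) 0 x (GS j 2%nat) H0).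
  rewrite coord_DerC2; apply Derive_ext; intros y; rewrite <- GV.
  now rewrite coord_DerC2. }
apply is_derive_unique.
assert (E0 : speed2 (G 0) x = speed2 g x) by now rewrite speed_eq, speed2_sum, !Ew.
replace (_ / _) with (2 * Re (hdot (DerC2 V x) (DerC2 g x)) / (2 * sqrt (speed2 (G 0) x))).
2:{ rewrite E0; field; apply Rgt_not_eq, sqrt_lt_R0; rewrite <- E0; auto. }
apply (is_derive_sqrt (fun e => speed2 (G e) x)); auto.
apply (is_derive_ext _ _ _ _ (fun e => eq_sym (speed_eq e x))).
assert (Q : forall j, is_derive (fun e => w j e x * w j e x) 0
   (coord (DerC2 V x) j * coord (DerC2 g x) j + coord (DerC2 g x) j * coord (DerC2 V x) j)).
{ intros j; rewrite <- !Ew.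
  apply (is_derive_mult (fun e => w j e x) (fun e => w j e x)); auto; exact Rmult_comm. }
rewrite hdot_coords; simpl Re.
match goal with |- is_derive _ _ ?l => replace l with
  (coord (DerC2 V x) 0 * coord (DerC2 g x) 0 + coord (DerC2 g x) 0 * coord (DerC2 V x) 0 +
  (coord (DerC2 V x) 1 * coord (DerC2 g x) 1 + coord (DerC2 g x) 1 * coord (DerC2 V x) 1) +
  (coord (DerC2 V x) 2 * coord (DerC2 g x) 2 + coord (DerC2 g x) 2 * coord (DerC2 V x) 2) +
  (coord (DerC2 V x) 3 * coord (DerC2 g x) 3 + coord (DerC2 g x) 3 * coord (DerC2 V x) 3)) by ring end.
assert (A : forall F K (a b : R), is_derive F 0 a -> is_derive K 0 b ->
  is_derive (fun t => F t + K t) 0 (a + b)) by (intros; apply (is_derive_plus F K 0); auto).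
auto 6.
Qed.
End FirstVariation.

Lemma is_derC2_frame g p q r x : smoothC2 g -> smooth p -> smooth q -> smooth r ->
  is_derC2 (frame_field g p q r) x
    (addC2 (addC2 (scaleC2 (RtoC (Derive p x)) (DerC2 g x))
                  (scaleC2 (RtoC (p x)) (DerC2 (DerC2 g) x)))
     (addC2 (addC2 (scaleC2 (RtoC (Derive q x)) (iC2 (DerC2 g x)))
                   (scaleC2 (RtoC (q x)) (iC2 (DerC2 (DerC2 g) x))))
            (addC2 (scaleC2 (RtoC (Derive r x)) (iC2 (g x)))
                   (scaleC2 (RtoC (r x)) (iC2 (DerC2 g x)))))).
Proof.
intros Hg Hp Hq Hr.
assert (D1 := smoothC2_is_derC2 _ x Hg).
assert (D2 := smoothC2_is_derC2 _ x (smoothC2_DerC2 _ Hg)).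
unfold frame_field; apply is_derC2_add; [|apply is_derC2_add].
- apply (is_derC2_scale p (DerC2 g)); auto using smooth_is_derive.
- apply (is_derC2_scale q (fun t => iC2 (DerC2 g t))); auto using smooth_is_derive, is_derC2_i.
- apply (is_derC2_scale r (fun t => iC2 (g t))); auto using smooth_is_derive, is_derC2_i.
Qed.

Lemma hdot_DerC2_frame g p q r x : regular_legendrian g -> smooth p -> smooth q -> smooth r ->
  Re (hdot (DerC2 (frame_field g p q r) x) (DerC2 g x)) =
  Derive p x * speed2 g x + p x * (Derive (speed2 g) x / 2) - q x * speed_rotation g x.
Proof.
intros Hg Hp Hq Hr.
rewrite (is_derC2_unique _ _ _ (is_derC2_frame g p q r x (rl_smooth _ Hg) Hp Hq Hr)).
unfold iC2; rewrite !hdot_add_l, !hdot_scale_l.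
destruct (legendrian_hdot_xx g Hg x) as [_ ->].
rewrite hdot_self, (legendrian_hdot_x_l g Hg); fold (speed2 g x); simpl; ring.
Qed.

(** The density of the derivative of the arclength is - r' k / 2 up to the
    derivative of p |g_x|. *)
Lemma first_variation L g p q r V G :
  P_space L g -> smooth p -> smooth q -> smooth r -> periodic L p ->
  (forall x, Derive r x = 2 * q x * speed2 g x) ->
  (forall x, V x = frame_field g p q r x) ->
  variation L g V G ->
  is_derive (fun e => 4 * arclength L (G e)) 0
    (- RInt (fun x => Derive r x * (2 * curvature g x)) 0 L).
Proof.
intros Pg Sp Sq Sr Pp Hr HV (G0 & GV & d & Hd & HG).
assert (Hg := proj1 Pg).
assert (D := is_derive_arclength L d G Hd (fun e He => proj1 (HG e He))
  (fun j n e x He => proj2 (HG e He) j n x)).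
evar_last; [exact (is_derive_scal _ _ 4 _ D)|].
set (v := fun x => sqrt (speed2 g x)).
assert (Sv : smooth v) by (apply smooth_arclength_density, Hg).
assert (Hv : forall x, 0 < v x) by (intros; apply sqrt_lt_R0, speed2_pos, Hg).
assert (Hvv : forall x, v x * v x = speed2 g x)
  by (intros; apply sqrt_def, Rlt_le, speed2_pos, Hg).
set (f := fun x => Derive r x * (2 * curvature g x)).
assert (Cf : forall x, continuous f x).
{ intros x; apply smooth_continuous, smooth_mult; [apply smooth_Derive, Sr|].
  apply smooth_mult; [apply smooth_const|apply smooth_curvature, Hg]. }
assert (E : forall x, partial_e (fun e x => sqrt (speed2 (G e) x)) 0 x =
   (- / 4) * f x + Derive (fun x => p x * v x) x).
{ intros x.
  rewrite (partial_e_density L d g V G Hd G0 GV (fun e He => proj1 (HG e He))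
    (fun j n e x He => proj2 (HG e He) j n x)).
  replace (DerC2 V x) with (DerC2 (frame_field g p q r) x).
  2:{ apply C2_ext; intros j; rewrite !coord_DerC2; apply Derive_ext; intros; now rewrite HV. }
  rewrite hdot_DerC2_frame by auto.
  rewrite Derive_mult by (apply smooth_ex_derive; auto).
  assert (Dv : Derive v x = Derive (speed2 g) x / (2 * v x)).
  { apply is_derive_unique, (is_derive_sqrt (speed2 g)); [|apply speed2_pos, Hg].
    apply smooth_is_derive, smooth_speed2, Hg. }
  unfold f; rewrite Dv, Hr, curvature_eq by auto; fold (v x); rewrite <- !Hvv.
  field; apply Rgt_not_eq, Hv. }
rewrite (RInt_add_Derive L (fun x => (- / 4) * f x) _ (fun x => p x * v x)); auto.
- assert (ES := RInt_scal (V := R_CompleteNormedModule) f 0 L (- / 4)).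
  change (ex_RInt f 0 L -> RInt (fun x => - / 4 * f x) 0 L = - / 4 * RInt f 0 L) in ES.
  transitivity (4 * (- / 4 * RInt f 0 L)); [|field].
  rewrite <- ES by (apply ex_RInt_of_continuous; auto).
  reflexivity.
- apply smooth_mult; auto.
- unfold v; rewrite (periodic_ends L p Pp).
  now rewrite (periodic_ends L _ (periodic_speed2 L g Pg)).
- intros x; apply (continuous_scal_r (- / 4) f); auto.
Qed.

(** * Pushing a Legendrian curve in its normal direction *)

(** The point a + y i b scaled back to the unit sphere, when a is a unit vector and
    b is orthogonal to it over C with squared length s. *)
Definition unit_push (y s : R) (a b : C2) : C2 :=
  scaleC2 (RtoC (/ sqrt (1 + y * y * s))) (addC2 a (scaleC2 (RtoC y) (iC2 b))).

Definition unit_push_vel (y s y1 s1 : R) (a b a1 b1 : C2) : C2 :=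
  let N := 1 + y * y * s in
  let N1 := (y1 * y + y * y1) * s + y * y * s1 in
  addC2 (scaleC2 (RtoC (- (N1 / (2 * sqrt N)) / sqrt N ^ 2)) (addC2 a (scaleC2 (RtoC y) (iC2 b))))
    (scaleC2 (RtoC (/ sqrt N))
      (addC2 a1 (addC2 (scaleC2 (RtoC y1) (iC2 b)) (scaleC2 (RtoC y) (iC2 b1))))).

Lemma push_factor_pos y s : 0 < s -> 0 < 1 + y * y * s.
Proof. intros Hs; assert (H := Rle_0_sqr y); unfold Rsqr in H; nra. Qed.

Lemma is_derC2_unit_push y s a b t y1 s1 a1 b1 : 0 < s t ->
  is_derive y t y1 -> is_derive s t s1 -> is_derC2 a t a1 -> is_derC2 b t b1 ->
  is_derC2 (fun t => unit_push (y t) (s t) (a t) (b t)) t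
    (unit_push_vel (y t) (s t) y1 s1 (a t) (b t) a1 b1).
Proof.
intros Hs Hy Hsd Ha Hb.
assert (HN := push_factor_pos (y t) (s t) Hs).
apply (is_derC2_scale (fun t => / sqrt (1 + y t * y t * s t))
  (fun t => addC2 (a t) (scaleC2 (RtoC (y t)) (iC2 (b t))))).
- apply (is_derive_inv (fun t => sqrt (1 + y t * y t * s t)));
    [|apply Rgt_not_eq, sqrt_lt_R0, HN].
  apply (is_derive_sqrt (fun t => 1 + y t * y t * s t)); auto.
  evar_last.
  + apply (is_derive_plus (fun _ => 1) (fun t => y t * y t * s t));
      [apply (is_derive_const (V := R_NormedModule))|].
    apply (is_derive_mult (fun t => y t * y t) s); [|exact Hsd|exact Rmult_comm].
    apply (is_derive_mult y y); [exact Hy|exact Hy|exact Rmult_comm].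
  + unfold plus, zero, mult; simpl; unfold plus, mult; simpl; ring.
- apply is_derC2_add; auto.
  apply (is_derC2_scale y (fun t => iC2 (b t))); auto using is_derC2_i.
Qed.

(** The pointwise relations satisfied by a = g, b = g_x, c = g_xx; here th1 is the
    derivative of the rotation angle. *)
Section PushAlgebra.
Variables (a b c : C2) (y s y1 s1 m th1 : R).
Hypothesis Hs : 0 < s.
Hypothesis Haa : hdot a a = RtoC 1.
Hypothesis Hba : hdot b a = RtoC 0.
Hypothesis Hbb : hdot b b = RtoC s.
Hypothesis Hca : hdot c a = RtoC (- s).
Hypothesis Hcb : hdot c b = (s1 / 2, m).

Let Hab : hdot a b = RtoC 0.
Proof. rewrite hdot_conj, Hba; apply injective_projections; simpl; ring. Qed.

Lemma unit_push_sphere : hdot (unit_push y s a b) (unit_push y s a b) = RtoC 1.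
Proof.
assert (HN := push_factor_pos y s Hs); assert (HS := sqrt_lt_R0 _ HN).
assert (HQ := sqrt_def _ (Rlt_le _ _ HN)).
set (q := sqrt (1 + y * y * s)) in *.
unfold unit_push, iC2; repeat rewrite ?hdot_add_l, ?hdot_add_r, ?hdot_scale_l, ?hdot_scale_r.
rewrite Haa, Hba, Hbb, Hab; fold q.
apply injective_projections; simpl; [|ring].
transitivity (/ q * / q * (1 + y * y * s)); [ring|].
rewrite <- HQ; field; lra.
Qed.

Let vel := addC2 (unit_push_vel y s y1 s1 a b b c) (scaleC2 (RtoC th1) (iC2 (unit_push y s a b))).

(** The real part vanishes because the pushed point stays on the sphere; the
    imaginary part is the stated condition divided by 1 + y^2 s. *)
Lemma unit_push_legendrian : th1 * (1 + y * y * s) = 2 * y * s - y * y * m ->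
  hdot vel (unit_push y s a b) = RtoC 0.
Proof.
intros Hth.
assert (HN := push_factor_pos y s Hs); assert (HS := sqrt_lt_R0 _ HN).
assert (HQ := sqrt_def _ (Rlt_le _ _ HN)).
unfold vel, unit_push_vel, unit_push, iC2; cbv zeta.
set (q := sqrt (1 + y * y * s)) in *.
repeat rewrite ?hdot_add_l, ?hdot_add_r, ?hdot_scale_l, ?hdot_scale_r.
rewrite Haa, Hba, Hbb, Hab, Hca, Hcb.
apply injective_projections; simpl.
- transitivity ((((y1 * y + y * y1) * s + y * y * s1) / (2 * q * q)) * (1 - (1 + y * y * s) / (q * q))).
  + field; lra.
  + rewrite HQ; field; lra.
- transitivity ((th1 * (1 + y * y * s) - (2 * y * s - y * y * m)) / (q * q)).
  + field; lra.
  + rewrite Hth; field; lra.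
Qed.

(** The vector paired with the velocity is orthogonal over C to the pushed point,
    so the rotation and the change of the normalizing factor do not contribute; the
    real part of what remains contains no derivative of y. *)
Lemma unit_push_regular : s - y * m - y * y * s * s <> 0 -> vel <> (RtoC 0, RtoC 0).
Proof.
intros Hn E; apply Hn.
assert (HN := push_factor_pos y s Hs); assert (HS := sqrt_lt_R0 _ HN).
assert (P : Re (hdot vel (addC2 b (scaleC2 (RtoC (y * s)) (iC2 a)))) =
  / sqrt (1 + y * y * s) * (s - y * m - y * y * s * s)).
{ unfold vel, unit_push_vel, unit_push, iC2; cbv zeta.
  repeat rewrite ?hdot_add_l, ?hdot_add_r, ?hdot_scale_l, ?hdot_scale_r.
  rewrite Haa, Hba, Hbb, Hab, Hca, Hcb.
  simpl; field; lra. }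
rewrite E in P.
assert (Z : forall z, Re (hdot (RtoC 0, RtoC 0) z) = 0).
{ intros z; unfold hdot; simpl; ring. }
rewrite Z in P.
apply (Rmult_eq_reg_l (/ sqrt (1 + y * y * s))); [rewrite <- P; ring|].
apply Rinv_neq_0_compat; lra.
Qed.
End PushAlgebra.

(** * The explicit deformation *)

(** The small root y of (k + w s) y^2 - 2 y + w = 0, written with the square root in
    the denominator so that it stays regular where k + w s vanishes. *)
Definition contact_root (w k s : R) : R := w / (1 + sqrt (1 - w * (k + w * s))).

(** The first equation is the Legendrian condition.  The second says that the
    regularity factor is a multiple of the square root of the discriminant, so the
    pushed curve is regular wherever the root is simple. *)
Lemma contact_root_spec w k s : 0 < 1 - w * (k + w * s) ->
  let y := contact_root w k s in
  w * (1 + s * y * y) = 2 * y - k * y * y /\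
  1 - k * y - s * y * y = sqrt (1 - w * (k + w * s)) * (1 + s * y * y).
Proof.
intros HD; unfold contact_root; cbv zeta.
assert (HS := sqrt_lt_R0 _ HD); assert (HQ := sqrt_def _ (Rlt_le _ _ HD)).
set (D := sqrt _) in *.
split.
- apply Rminus_diag_uniq.
  transitivity (w * (w * (k + w * s) - 1 + D * D) / ((1 + D) * (1 + D))); [field; lra|].
  rewrite HQ; field; lra.
- apply Rminus_diag_uniq.
  transitivity ((1 - w * (k + w * s) - D * D) / (1 + D)); [field; lra|].
  rewrite HQ; field; lra.
Qed.

(** Equals k |g_x|. *)
Definition rotation_ratio (g : R -> C2) (x : R) : R := speed_rotation g x / speed2 g x.

Definition discr (g : R -> C2) (q : R -> R) (e x : R) : R :=
  1 - 2 * e * q x * (rotation_ratio g x + 2 * e * q x * speed2 g x).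

Definition height (g : R -> C2) (q : R -> R) (e x : R) : R :=
  contact_root (2 * e * q x) (rotation_ratio g x) (speed2 g x).

(** The choice w = 2 e q in the height makes the Legendrian condition read
    e r_x (1 + y^2 s) = 2 y s - y^2 m when r_x = 2 q s. *)
Definition deform (g : R -> C2) (q r : R -> R) (e x : R) : C2 :=
  rot (e * r x) (unit_push (height g q e x) (speed2 g x) (g x) (DerC2 g x)).

Section Deformation.
Variables (L : R) (g : R -> C2) (q r : R -> R).
Hypothesis Pg : P_space L g.
Hypothesis Sq : smooth q.
Hypothesis Sr : smooth r.
Hypothesis Pq : periodic L q.
Hypothesis Pr : periodic L r.
Hypothesis Hr : forall x, Derive r x = 2 * q x * speed2 g x.

Lemma smooth_rotation_ratio : smooth (rotation_ratio g).
Proof.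
destruct Pg as [Hg _].
apply smooth_mult; [apply smooth_speed_rotation, Hg|].
apply smooth_inv; [|apply smooth_speed2, Hg].
intros x; apply Rgt_not_eq, speed2_pos, Hg.
Qed.

Lemma deform_periodic e : periodic L (deform g q r e).
Proof.
intros x; unfold deform, height, rotation_ratio.
rewrite Pq, Pr, (periodic_speed2 L g Pg), (periodic_speed_rotation L g Pg), (proj2 Pg).
now rewrite (periodic_DerC2 L g (rl_smooth _ (proj1 Pg)) (proj2 Pg)).
Qed.

Lemma deform_at_0 x : deform g q r 0 x = g x.
Proof.
unfold deform, height, unit_push, contact_root, rot; apply C2_ext; intros j.
replace (2 * 0 * q x / _) with 0 by (unfold Rdiv; ring).
rewrite !Rmult_0_l, cos_0, sin_0, Rplus_0_r, sqrt_1, Rinv_1.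
rewrite (coord_scale 1), coord_scale, coord_add, coord_scale; ring.
Qed.

Lemma height_eq e x : height g q e x = e * (2 * q x / (1 + sqrt (discr g q e x))).
Proof. unfold height, contact_root, discr, Rdiv; ring. Qed.

Section Reparametrized.
Variables (d : R) (p : R -> R).
Hypothesis Hdisc : forall e x, Rabs e < d -> 0 < discr g q e x.
Hypothesis Sp : smooth p.

Let X e x := x + e * p x.

Let lift f : smooth f -> smooth_strip d (fun e x => f (X e x)).
Proof. intros Hf; apply (smooth_strip_comp d f p Hf Sp). Qed.

(** The height divided by e; its value q at e = 0 is the initial normal velocity. *)
Lemma height_factor_smooth :
  smooth_strip d (fun e x => 2 * q (X e x) / (1 + sqrt (discr g q e (X e x)))).
Proof.
intros n.
assert (Q := lift q Sq n).
assert (K := lift _ smooth_rotation_ratio n).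
assert (S := lift _ (smooth_speed2 g (proj1 Pg)) n).
assert (W : diff_strip d n (fun e x => 2 * e * q (X e x))).
{ apply (diff_strip_mult d n (fun e _ => 2 * e) (fun e x => q (X e x))); auto.
  apply (diff_strip_mult d n (fun _ _ => 2) (fun e _ => e)); auto using diff_strip_const, diff_strip_param. }
apply (diff_strip_mult d n (fun e x => 2 * q (X e x)) (fun e x => / (1 + sqrt (discr g q e (X e x))))).
- apply (diff_strip_mult d n (fun _ _ => 2) (fun e x => q (X e x))); auto using diff_strip_const.
- apply (diff_strip_inv d n (fun e x => 1 + sqrt (discr g q e (X e x)))).
  + intros e x He; generalize (sqrt_pos (discr g q e (X e x))); lra.
  + apply (diff_strip_plus d n (fun _ _ => 1)); [apply diff_strip_const|].
    apply (diff_strip_sqrt d n (fun e x => discr g q e (X e x))); [intros; auto|].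
    apply (diff_strip_plus d n (fun _ _ => 1)); [apply diff_strip_const|].
    apply (diff_strip_opp d n (fun e x => 2 * e * q (X e x) *
      (rotation_ratio g (X e x) + 2 * e * q (X e x) * speed2 g (X e x)))).
    apply (diff_strip_mult d n (fun e x => 2 * e * q (X e x))); auto.
    apply (diff_strip_plus d n (fun e x => rotation_ratio g (X e x))); auto.
    apply (diff_strip_mult d n (fun e x => 2 * e * q (X e x))); auto.
Qed.

Lemma height_smooth : smooth_strip d (fun e x => height g q e (X e x)).
Proof.
intros n; eapply diff_strip_ext; [intros; symmetry; apply height_eq|].
apply (diff_strip_mult d n (fun e _ => e)); [apply diff_strip_param|apply height_factor_smooth].
Qed.

Lemma deform_smooth : smooth_stripC2 d (fun e x => deform g q r e (X e x)).
Proof.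
assert (Hg := proj1 Pg); assert (S1 := rl_smooth _ Hg).
assert (Y := height_smooth).
apply (smooth_stripC2_rot d (fun e x => e * r (X e x))).
{ intros n; apply (diff_strip_mult d n (fun e _ => e)); [apply diff_strip_param|apply (lift r Sr)]. }
apply (smooth_stripC2_scale d
  (fun e x => / sqrt (1 + height g q e (X e x) * height g q e (X e x) * speed2 g (X e x)))).
- intros n.
  assert (HN : forall e x, 0 < 1 + height g q e (X e x) * height g q e (X e x) * speed2 g (X e x)).
  { intros; apply push_factor_pos, speed2_pos, Hg. }
  apply (diff_strip_inv d n
    (fun e x => sqrt (1 + height g q e (X e x) * height g q e (X e x) * speed2 g (X e x)))).
  + intros e x _; apply Rgt_not_eq, sqrt_lt_R0, HN.
  + apply (diff_strip_sqrt d n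
     (fun e x => 1 + height g q e (X e x) * height g q e (X e x) * speed2 g (X e x))); auto.
    apply (diff_strip_plus d n (fun _ _ => 1)); [apply diff_strip_const|].
    apply (diff_strip_mult d n (fun e x => height g q e (X e x) * height g q e (X e x))).
    * apply (diff_strip_mult d n (fun e x => height g q e (X e x))); apply Y.
    * apply (lift _ (smooth_speed2 g Hg)).
- apply (smooth_stripC2_add d (fun e x => g (X e x))).
  + intros j; apply (lift (fun x => coord (g x) j)), S1.
  + apply (smooth_stripC2_scale d (fun e x => height g q e (X e x))); [exact Y|].
    apply (smooth_stripC2_i d (fun e x => DerC2 g (X e x))).
    intros j; apply (lift (fun x => coord (DerC2 g x) j)), smoothC2_DerC2, S1.
Qed.

Lemma deform_velocity x : 0 < d ->
  DerC2 (fun e => deform g q r e (X e x)) 0 = frame_field g p q r x.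
Proof.
intros Hd.
assert (Hg := proj1 Pg); assert (S1 := rl_smooth _ Hg).
assert (H0 : Rabs 0 < d) by (rewrite Rabs_R0; exact Hd).
assert (X0 : X 0 x = x) by (unfold X; ring).
assert (DX : is_derive (fun e => X e x) 0 (p x)) by (unfold X; auto_derive; auto; ring).
assert (mulE : forall f l, is_derive f 0 l -> is_derive (fun e : R => e * f e) 0 (f 0)).
{ intros f l Hf; evar_last.
  - apply (is_derive_mult (fun e : R => e) f 0 1 l); [|exact Hf|exact Rmult_comm].
    auto_derive; auto.
  - unfold plus, mult; simpl; ring. }
assert (Dth : is_derive (fun e => e * r (X e x)) 0 (r x)).
{ replace (r x) with (r (X 0 x)) by now rewrite X0.
  apply (mulE (fun e => r (X e x)) (p x * Derive r (X 0 x))).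
  apply (is_derive_comp r (fun e => X e x)); auto using smooth_is_derive. }
assert (Dy : is_derive (fun e => height g q e (X e x)) 0 (q x)).
{ apply (is_derive_ext (fun e => e * (2 * q (X e x) / (1 + sqrt (discr g q e (X e x)))))).
  { intros; symmetry; apply height_eq. }
  destruct (diff_strip_elim d 0 _ (height_factor_smooth 1%nat)) as (_ & D & _).
  specialize (D 0 x H0); apply mulE in D.
  replace (q x) with (2 * q (X 0 x) / (1 + sqrt (discr g q 0 (X 0 x)))); auto.
  rewrite X0; unfold discr.
  replace (1 - _) with 1 by ring; rewrite sqrt_1; field. }
assert (Ds : is_derive (fun e => speed2 g (X e x)) 0 (p x * Derive (speed2 g) (X 0 x))).
{ apply (is_derive_comp (speed2 g) (fun e => X e x)); auto.
  apply smooth_is_derive, smooth_speed2, Hg. }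
assert (Da := is_derC2_comp g (fun e => X e x) 0 _ _ DX (smoothC2_is_derC2 g (X 0 x) S1)).
assert (Db := is_derC2_comp (DerC2 g) (fun e => X e x) 0 _ _ DX
  (smoothC2_is_derC2 _ (X 0 x) (smoothC2_DerC2 _ S1))).
assert (Hs : 0 < speed2 g (X 0 x)) by apply speed2_pos, Hg.
assert (Du := is_derC2_unit_push (fun e => height g q e (X e x)) (fun e => speed2 g (X e x))
  (fun e => g (X e x)) (fun e => DerC2 g (X e x)) 0 _ _ _ _ Hs Dy Ds Da Db).
apply is_derC2_unique.
assert (D := is_derC2_rot _ _ 0 _ _ Dth Du).
match type of D with is_derC2 _ _ ?v => replace (frame_field g p q r x) with v end; [exact D|].
assert (Y0 : height g q 0 (X 0 x) = 0) by (rewrite height_eq; ring).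
cbv beta; rewrite Y0, X0, Rmult_0_l.
unfold unit_push_vel, unit_push; cbv zeta.
rewrite ?Rmult_0_l, ?Rmult_0_r, ?Rmult_0_l, ?Rplus_0_r, sqrt_1.
replace (- (_ / (2 * 1)) / 1 ^ 2) with 0 by field.
rewrite Rinv_1.
unfold frame_field.
generalize (g x) (DerC2 g x) (DerC2 (DerC2 g) x) (p x) (q x) (r x); clear; intros.
unfold rot; rewrite cos_0, sin_0.
c2_coords; repeat apply injective_projections; simpl; ring.
Qed.
End Reparametrized.

Lemma deform_legendrian d e : (forall e x, Rabs e < d -> 0 < discr g q e x) -> Rabs e < d ->
  regular_legendrian (deform g q r e).
Proof.
intros Hdisc He.
(* Joint smoothness is available for the reparametrized family; no
   reparametrization is the case p = 0. *)
set (X := fun e x : R => x + e * (fun _ => 0) x).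
assert (Hg := proj1 Pg); assert (S1 := rl_smooth _ Hg).
assert (EX : forall e x, X e x = x) by (intros; unfold X; ring).
assert (Sm : smoothC2 (deform g q r e)).
{ intros j; apply (smooth_ext (fun x => coord (deform g q r e (X e x)) j)).
  - intros; now rewrite EX.
  - apply (smooth_slice d (fun e x => coord (deform g q r e (X e x)) j) e); auto.
    apply (deform_smooth d (fun _ => 0) Hdisc (smooth_const 0)). }
assert (D : forall x, exists y1,
  is_derC2 (deform g q r e) x (rot (e * r x) (addC2
    (unit_push_vel (height g q e x) (speed2 g x) y1 (Derive (speed2 g) x) (g x) (DerC2 g x)
       (DerC2 g x) (DerC2 (DerC2 g) x))
    (scaleC2 (RtoC (e * Derive r x)) (iC2 (unit_push (height g q e x) (speed2 g x) (g x) (DerC2 g x))))))).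
{ intros x.
  destruct (diff_strip_elim d 0 _ (height_smooth d (fun _ => 0) Hdisc (smooth_const 0) 1%nat)) as (_ & _ & Dy & _).
  specialize (Dy e x He).
  eexists; apply (is_derC2_rot (fun x => e * r x)).
  - apply (is_derive_scal r x e), smooth_is_derive, Sr.
  - apply is_derC2_unit_push.
    + apply speed2_pos, Hg.
    + apply (is_derive_ext (fun x => height g q e (X e x))); [intros; now rewrite EX|exact Dy].
    + apply smooth_is_derive, smooth_speed2, Hg.
    + apply smoothC2_is_derC2, S1.
    + apply smoothC2_is_derC2, smoothC2_DerC2, S1. }
assert (Hs := speed2_pos g Hg).
assert (R1 := fun x => contact_root_spec _ _ _ (Hdisc e x He)).
assert (Em : forall x, speed_rotation g x = rotation_ratio g x * speed2 g x).
{ intros x; unfold rotation_ratio; field; apply Rgt_not_eq, Hs. }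
split; auto.
- intros x; unfold deform; rewrite hdot_rot.
  apply unit_push_sphere; auto.
  + apply (rl_sphere _ Hg).
  + apply (rl_legendrian _ Hg).
  + apply hdot_self.
- intros x; destruct (D x) as [y1 Dx]; rewrite (is_derC2_unique _ _ _ Dx); intros E.
  apply rot_inj0 in E; revert E.
  destruct (legendrian_hdot_xx g Hg x) as [Hca Hcb].
  apply (unit_push_regular _ _ _ _ _ _ _ _ _ (Hs x) (rl_sphere _ Hg x) (rl_legendrian _ Hg x)
    (hdot_self _) Hca Hcb).
  destruct (R1 x) as [_ R2]; fold (height g q e x) in R2.
  rewrite Em; apply Rgt_not_eq.
  replace (_ - _) with (speed2 g x *
    (1 - rotation_ratio g x * height g q e x - speed2 g x * height g q e x * height g q e x)) by ring.
  rewrite R2; repeat apply Rmult_lt_0_compat; auto.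
  + apply sqrt_lt_R0, (Hdisc e x He).
  + generalize (push_factor_pos (height g q e x) _ (Hs x)); lra.
- intros x; destruct (D x) as [y1 Dx]; rewrite (is_derC2_unique _ _ _ Dx).
  unfold deform; rewrite hdot_rot.
  destruct (legendrian_hdot_xx g Hg x) as [Hca Hcb].
  apply (unit_push_legendrian _ _ _ _ _ _ _ _ _ (Hs x) (rl_sphere _ Hg x) (rl_legendrian _ Hg x)
    (hdot_self _) Hca Hcb).
  destruct (R1 x) as [R2 _]; fold (height g q e x) in R2.
  rewrite Hr, Em.
  transitivity (speed2 g x * (2 * e * q x * (1 + speed2 g x * height g q e x * height g q e x))); [ring|].
  rewrite R2; ring.
Qed.
End Deformation.

(** * Every tangent vector is a velocity *)

Lemma regular_legendrian_comp h phi : regular_legendrian h -> smooth phi ->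
  (forall x, Derive phi x <> 0) -> smoothC2 (fun x => h (phi x)) ->
  regular_legendrian (fun x => h (phi x)).
Proof.
intros Hh Hp Hn Hs.
assert (D : forall x, DerC2 (fun x => h (phi x)) x =
  scaleC2 (RtoC (Derive phi x)) (DerC2 h (phi x))).
{ intros x; apply is_derC2_unique, is_derC2_comp; [apply smooth_is_derive, Hp|].
  apply smoothC2_is_derC2, Hh. }
split; auto.
- intros x; apply (rl_sphere _ Hh).
- intros x; rewrite D; intros E.
  assert (P := hnorm2_scale_real (Derive phi x) (DerC2 h (phi x))); rewrite E in P.
  replace (hnorm2 (RtoC 0, RtoC 0)) with 0 in P by (unfold hnorm2, hdot; simpl; ring).
  assert (Q := speed2_pos h Hh (phi x)); unfold speed2 in Q.
  assert (Q' := Hn x).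
  assert (0 < Derive phi x * Derive phi x) by (apply Rsqr_pos_lt; auto).
  nra.
- intros x; rewrite D, hdot_scale_l, (rl_legendrian _ Hh); ring.
Qed.

(** The coefficients are periodic, hence bounded, so one bound on e serves all x. *)
Lemma deformation_interval L g p q : 0 < L -> P_space L g ->
  smooth p -> smooth q -> periodic L p -> periodic L q ->
  exists d, 0 < d /\ forall e x, Rabs e < d -> 0 < discr g q e x /\ 0 < 1 + e * Derive p x.
Proof.
intros HL Pg Sp Sq Pp Pq.
destruct (periodic_bounded L (fun x => q x * rotation_ratio g x)) as [B1 [P1 H1]]; auto.
{ apply smooth_mult; auto; apply (smooth_rotation_ratio L), Pg. }
{ intros x; unfold rotation_ratio.
  now rewrite Pq, (periodic_speed_rotation L g Pg), (periodic_speed2 L g Pg). }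
destruct (periodic_bounded L (fun x => q x * q x * speed2 g x)) as [B2 [P2 H2]]; auto.
{ apply smooth_mult; [apply smooth_mult; auto|apply smooth_speed2, Pg]. }
{ intros x; now rewrite Pq, (periodic_speed2 L g Pg). }
destruct (periodic_bounded L (Derive p)) as [B3 [P3 H3]]; auto.
{ apply smooth_Derive, Sp. }
{ apply periodic_Derive; auto. }
set (B := 1 + B1 + B2 + B3).
assert (HB : 1 <= B) by (unfold B; lra).
(* For |e| < 1 / (8 B) each of e q kappa, e q^2 s, e p' is at most 1/8 in absolute
   value, where kappa is the rotation ratio, and the discriminant is at least
   1 - 2/8 - 4/64. *)
assert (Hd : 0 < / (8 * B)) by (apply Rinv_0_lt_compat; lra).
exists (/ (8 * B)); split; auto.
intros e x He.
assert (Hsmall : forall u, Rabs u <= B -> Rabs (e * u) <= / 8).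
{ intros u Hu; rewrite Rabs_mult.
  replace (/ 8) with (/ (8 * B) * B) by (field; lra).
  apply Rmult_le_compat; auto using Rabs_pos; lra. }
assert (E1 := Hsmall (q x * rotation_ratio g x)).
assert (E2 := Hsmall (q x * q x * speed2 g x)).
assert (E3 := Hsmall (Derive p x)).
specialize (H1 x); specialize (H2 x); specialize (H3 x).
assert (E1' : Rabs (e * (q x * rotation_ratio g x)) <= / 8) by (apply E1; unfold B; lra).
assert (E2' : Rabs (e * (q x * q x * speed2 g x)) <= / 8) by (apply E2; unfold B; lra).
assert (E3' : Rabs (e * Derive p x) <= / 8) by (apply E3; unfold B; lra).
assert (E4 : Rabs e <= / 8).
{ apply Rlt_le, (Rlt_le_trans _ _ _ He), Rinv_le_contravar; lra. }
apply Rabs_le_between in E1'; apply Rabs_le_between in E3'.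
split; [|lra].
replace (discr g q e x) with
  (1 - 2 * (e * (q x * rotation_ratio g x)) - 4 * (e * (e * (q x * q x * speed2 g x))))
  by (unfold discr; ring).
assert (E5 : Rabs (e * (e * (q x * q x * speed2 g x))) <= / 8 * / 8).
{ rewrite Rabs_mult; apply Rmult_le_compat; auto using Rabs_pos. }
apply Rabs_le_between in E5; lra.
Qed.

(** Deform within the Legendrian curves to produce the coefficients q and r, then
    reparametrize to produce p. *)
Lemma variation_exists L g p q r V : 0 < L -> P_space L g ->
  smooth p -> smooth q -> smooth r ->
  periodic L p -> periodic L q -> periodic L r ->
  (forall x, Derive r x = 2 * q x * speed2 g x) ->
  (forall x, V x = frame_field g p q r x) ->
  exists G, variation L g V G.
Proof.
intros HL Pg Sp Sq Sr Pp Pq Pr Hr HV.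
destruct (deformation_interval L g p q HL Pg Sp Sq Pp Pq) as (d & Hd & HB).
assert (Hdisc : forall e x, Rabs e < d -> 0 < discr g q e x) by (intros; apply HB; auto).
assert (DS := deform_smooth L g q r Pg Sq Sr d p Hdisc Sp).
exists (fun e x => deform g q r e (x + e * p x)).
split; [|split].
- intros x; rewrite deform_at_0; f_equal; ring.
- intros x; rewrite HV; apply (deform_velocity L g q r Pg Sq Sr d p Hdisc Sp x Hd).
- exists d; split; auto; intros e He; split.
  2:{ intros j n x; apply (DS j n e x He). }
  split.
  + assert (Hphi : smooth (fun x => x + e * p x)).
    { apply smooth_plus; [apply smooth_id|apply smooth_mult; auto using smooth_const]. }
    assert (Sm : smoothC2 (fun x => deform g q r e (x + e * p x))).
    { intros j; apply (smooth_slice d (fun e x => coord (deform g q r e (x + e * p x)) j)); auto. }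
    apply (regular_legendrian_comp (deform g q r e) (fun x => x + e * p x)); auto.
    * apply (deform_legendrian L g q r Pg Sq Sr Hr d e); auto.
    * intros x.
      replace (Derive (fun x => x + e * p x) x) with (1 + e * Derive p x).
      -- apply Rgt_not_eq, (proj2 (HB e x He)).
      -- symmetry; apply is_derive_unique; auto_derive; [apply smooth_ex_derive, Sp|].
         change (fun x0 => p x0) with p; ring.
  + intros x; rewrite Pp.
    replace (x + L + e * p x) with (x + e * p x + L) by ring.
    apply (deform_periodic L g q r Pg Pq Pr e).
Qed.

(** * The differential of arclength and the kernel of the symplectic form *)

Lemma differential_arclength L g p q r V : 0 < L -> P_space L g ->
  smooth p -> smooth q -> smooth r ->
  periodic L p -> periodic L q -> periodic L r ->
  (forall x, Derive r x = 2 * q x * speed2 g x) ->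
  (forall x, V x = frame_field g p q r x) ->
  is_differential L (fun h => 4 * arclength L h) g V
    (- RInt (fun x => Derive r x * (2 * curvature g x)) 0 L).
Proof.
intros; split.
- apply (variation_exists L g p q r V); auto.
- intros G HG; apply (first_variation L g p q r V G); auto.
Qed.

(** The existence of one variation pins down the value. *)
Lemma is_differential_unique L H g V c1 c2 :
  is_differential L H g V c1 -> is_differential L H g V c2 -> c1 = c2.
Proof.
intros [[G HG] H1] [_ H2].
rewrite <- (is_derive_unique _ _ _ (H1 G HG)); apply is_derive_unique, H2, HG.
Qed.

Lemma Omega_ext L g V W V' W' : (forall x, V x = V' x) -> (forall x, W x = W' x) ->
  Omega L g V W = Omega L g V' W'.
Proof.
intros HV HW; unfold Omega; f_equal; apply RInt_ext; intros x _; now rewrite HV, HW.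
Qed.

Section HamiltonianField.
Variables (L : R) (hL : 0 < L) (g : R -> C2) (Pg : P_space L g).

Let qX x := Derive (curvature g) x / speed2 g x.
Let rX x := 2 * curvature g x.
Let X x := addC2 (scaleC2 (RtoC (qX x)) (iC2 (DerC2 g x))) (scaleC2 (RtoC (rX x)) (iC2 (g x))).

Let X_frame x : X x = frame_field g (fun _ => 0) qX rX x.
Proof.
apply C2_ext; intros j; unfold X, frame_field.
rewrite !coord_add, !coord_scale; ring.
Qed.

Let SrX : smooth rX.
Proof. apply smooth_mult; [apply smooth_const|apply smooth_curvature, Pg]. Qed.

Let PrX : periodic L rX.
Proof. intros x; unfold rX; now rewrite (periodic_curvature L g Pg). Qed.

Let SqX : smooth qX.
Proof.
apply smooth_mult; [apply smooth_Derive, smooth_curvature, Pg|].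
apply smooth_inv; [|apply smooth_speed2, Pg].
intros x; apply Rgt_not_eq, speed2_pos, Pg.
Qed.

Let PqX : periodic L qX.
Proof.
intros x; unfold qX; rewrite (periodic_speed2 L g Pg).
now rewrite (periodic_Derive L _ (smooth_curvature g (proj1 Pg)) (periodic_curvature L g Pg)).
Qed.

Let HrX x : Derive rX x = 2 * qX x * speed2 g x.
Proof.
unfold rX, qX; rewrite Derive_scal; field; apply Rgt_not_eq, speed2_pos, Pg.
Qed.

Lemma curvature_field_tangent : tangent_P L g X.
Proof.
exists (fun _ => 0), qX, rX; repeat split; auto; apply smooth_const.
Qed.

Lemma Omega_tangent V W p1 q1 r1 p2 q2 r2 :
  smooth r1 -> smooth r2 -> periodic L r1 -> periodic L r2 ->
  (forall x, Derive r1 x = 2 * q1 x * speed2 g x) ->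
  (forall x, Derive r2 x = 2 * q2 x * speed2 g x) ->
  (forall x, V x = frame_field g p1 q1 r1 x) ->
  (forall x, W x = frame_field g p2 q2 r2 x) ->
  Omega L g V W = - RInt (fun x => Derive r1 x * r2 x) 0 L.
Proof.
intros S1 S2 E1 E2 D1 D2 HV HW.
rewrite (Omega_ext L g V W _ _ HV HW).
apply (Omega_frame g (proj1 Pg)); auto using (fun f => @periodic_ends R L f).
Qed.

(** Equivalent fields have coefficients r that differ by a constant c, and
    int r1' c = 0. *)
Lemma hamiltonian_of_equiv W : tangent_equiv L g W X ->
  hamiltonian_rep L (fun h => 4 * arclength L h) g W.
Proof.
intros (TW & _ & c & f & Sf & Pf & HWX); split; auto.
intros V (p1 & q1 & r1 & (Sp & Sq & Sr) & (Pp & Pq & Pr) & Hr & HV).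
destruct TW as (p & q & r & (Sp' & Sq' & Sr') & (Pp' & Pq' & Pr') & Hr' & HW).
assert (Er : forall x, r x = rX x + c).
{ intros x.
  assert (A := frame_field_r g (proj1 Pg) p q r x); rewrite <- HW in A.
  assert (B := frame_field_r g (proj1 Pg) (fun _ => 0) qX rX x); rewrite <- X_frame in B.
  assert (C := f_equal (fun z => Im (hdot z (g x))) (HWX x)); cbv beta in C.
  rewrite hdot_sub_l in C; unfold iC2 in C.
  rewrite hdot_add_l, !hdot_scale_l, (rl_legendrian _ (proj1 Pg)), (rl_sphere _ (proj1 Pg)) in C.
  change (Im (hdot (W x) (g x)) - Im (hdot (X x) (g x)) =
    Im (Cplus (Cmult (RtoC c) (Cmult Ci (RtoC 1))) (Cmult (RtoC (f x)) (RtoC 0)))) in C.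
  rewrite A, B in C; simpl in C; lra. }
rewrite (Omega_tangent V W p1 q1 r1 p q r); auto.
rewrite (RInt_add_Derive L (fun x => Derive r1 x * rX x) _ (fun x => c * r1 x)).
- apply (differential_arclength L g p1 q1 r1); auto.
- apply smooth_mult; auto using smooth_const.
- now rewrite (periodic_ends L r1 Pr).
- intros x; apply smooth_continuous, smooth_mult; auto using smooth_Derive.
- intros x; rewrite Er, Derive_scal; ring.
Qed.

(** The test field has coefficient r equal to rho'; its coefficient q is then
    determined by tangency. *)
Lemma equiv_of_hamiltonian W : hamiltonian_rep L (fun h => 4 * arclength L h) g W ->
  tangent_equiv L g W X.
Proof.
intros [TW HH]; split; [exact TW|split; [exact curvature_field_tangent|]].
destruct TW as (p & q & r & (Sp' & Sq' & Sr') & (Pp' & Pq' & Pr') & Hr' & HW).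
set (rho := fun x => r x - rX x).
assert (Srho : smooth rho) by (apply smooth_minus; auto).
assert (Prho : periodic L rho) by (intros x; unfold rho; now rewrite Pr', PrX).
assert (Hs : forall x, speed2 g x <> 0) by (intros x; apply Rgt_not_eq, speed2_pos, Pg).
assert (Crho : forall x, rho x = rho 0).
{ apply (constant_of_orthogonal L); auto.
  set (u := Derive rho).
  assert (Su : smooth u) by (apply smooth_Derive, Srho).
  assert (Pu : periodic L u) by (apply periodic_Derive; auto).
  set (v := fun x => Derive u x * / (2 * speed2 g x)).
  assert (Sv : smooth v).
  { apply smooth_mult; [apply smooth_Derive, Su|].
    apply smooth_inv; [intros x; specialize (Hs x); lra|].
    apply smooth_mult; [apply smooth_const|apply smooth_speed2, Pg]. }
  assert (Pv : periodic L v).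
  { intros x; unfold v; now rewrite (periodic_Derive L u Su Pu), (periodic_speed2 L g Pg). }
  assert (Hu : forall x, Derive u x = 2 * v x * speed2 g x).
  { intros x; unfold v; field; auto. }
  assert (TV : tangent_P L g (frame_field g (fun _ => 0) v u)).
  { exists (fun _ => 0), v, u; repeat split; auto; apply smooth_const. }
  specialize (HH _ TV).
  rewrite (Omega_tangent _ W (fun _ => 0) v u p q r) in HH; auto.
  assert (HX := differential_arclength L g (fun _ => 0) v u (frame_field g (fun _ => 0) v u)
    hL Pg (smooth_const 0) Sv Su (fun _ => eq_refl) Pv Pu Hu (fun _ => eq_refl)).
  assert (E := is_differential_unique _ _ _ _ _ _ HH HX); clear HH HX.
  fold rX in E.
  assert (Ex : forall f, smooth f -> ex_RInt (fun x => Derive u x * f x) 0 L).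
  { intros f Sf; apply ex_RInt_of_continuous; intros x.
    apply smooth_continuous, smooth_mult; auto using smooth_Derive. }
  assert (Em := RInt_minus (V := R_CompleteNormedModule) (fun x => Derive u x * r x)
    (fun x => Derive u x * rX x) 0 L (Ex r Sr') (Ex rX SrX)).
  transitivity (RInt (fun x => minus (Derive u x * r x) (Derive u x * rX x)) 0 L).
  - apply RInt_ext; intros x _; unfold rho, minus, plus, opp; simpl; ring.
  - refine (eq_trans Em _); unfold minus, plus, opp; simpl.
    change (fun x => Derive u x * rX x) with (fun x => Derive u x * (2 * curvature g x)); lra. }
exists (rho 0), p; split; [exact Sp'|split; [exact Pp'|]].
intros x.
assert (Er : r x = rX x + rho 0) by (rewrite <- (Crho x); unfold rho; ring).
assert (Eq : q x = qX x).
{ assert (D : Derive rho x = 0).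
  { rewrite (Derive_ext _ (fun _ => rho 0) x Crho); apply Derive_const. }
  unfold rho in D; rewrite Derive_minus in D by (apply smooth_ex_derive; auto).
  rewrite Hr', HrX in D.
  apply (Rmult_eq_reg_r (2 * speed2 g x)); [lra|specialize (Hs x); lra]. }
apply C2_ext; intros j.
rewrite coord_sub, HW, X_frame; unfold frame_field.
rewrite !coord_add, !coord_scale, Er, Eq; ring.
Qed.
End HamiltonianField.

Theorem proposition3p3 (L : R) (hL : 0 < L) :
  functional_on_Q L (arclength L) /\
  forall g : R -> C2, P_space L g ->
    let X : R -> C2 := fun x =>
      addC2 (scaleC2 (RtoC (Derive (curvature g) x / speed2 g x)) (iC2 (DerC2 g x)))
            (scaleC2 (RtoC (2 * curvature g x)) (iC2 (g x))) in
    tangent_P L g X /\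
    forall W : R -> C2,
      hamiltonian_rep L (fun h => 4 * arclength L h) g W <-> tangent_equiv L g W X.
Proof.
split; [apply arclength_functional|intros g Pg X].
split; [apply (curvature_field_tangent L g Pg)|intros W; split].
- apply (equiv_of_hamiltonian L hL g Pg).
- apply (hamiltonian_of_equiv L hL g Pg).
Qed.
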